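(* Let $(H,q)$ be a non-degenerate lattice of rank $n$ and signature $(r,s)$. Then for each of the signatures $(r+3,s)$, $(r+2,s+1)$, $(r+1,s+2)$, $(r,s+3)$ there is an isometric embedding of rational quadratic spaces $(H\otimes_{\mathbb{Z}}\mathbb{Q},q)\hookrightarrow(L_{\mathbb{Q}},q_{st})$, where $L_{\mathbb{Q}}=\mathbb{Q}^{n+3}$ and $q_{st}=\sum_{i=1}^{n+3}\pm z_i^2$ is a diagonal form with all coefficients $\pm1$ having the chosen signature.
   Context: A lattice is a free abelian group with an integer-valued quadratic form; it is non-degenerate if the associated bilinear form is non-degenerate. *)

(* Defs.v *)
From HB Require Import structures.
From mathcomp Require Import all_boot all_order all_algebra.
Set Implicit Arguments. Unset Strict Implicit. Unset Printing Implicit Defensive.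
Import Order.TTheory GRing.Theory Num.Theory.
Local Open Scope ring_scope.

(* A lattice of rank n is Z^n (row vectors 'rV[int]_n) with an integer-valued
   quadratic form.  Every integer-valued quadratic form on Z^n is of the form
   q(x) = x A x^T for some integer matrix A (e.g. A upper triangular). *)
Definition latq (n : nat) (A : 'M[int]_n) (x : 'rV[int]_n) : int :=
  (x *m A *m x^T) 0 0.

Definition latb (n : nat) (A : 'M[int]_n) (x y : 'rV[int]_n) : int :=
  latq A (x + y) - latq A x - latq A y.

Definition lat_nondeg (n : nat) (A : 'M[int]_n) : Prop :=
  forall x : 'rV[int]_n, (forall y, latb A x y = 0) -> x = 0.

Definition ratq (n : nat) (A : 'M[int]_n) (x : 'rV[rat]_n) : rat :=
  (x *m map_mx (fun z : int => z%:~R) A *m x^T) 0 0.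

(* Signature (r,s) of a rational quadratic form Q on Q^n: after an invertible
   linear change of variables Q becomes  sum_i d_i x_i^2  with exactly r
   positive and s negative coefficients (well defined by Sylvester's law). *)
Definition has_signature (n : nat) (Q : 'rV[rat]_n -> rat) (r s : nat) : Prop :=
  exists P : 'M[rat]_n, P \in unitmx /\
  exists d : 'rV[rat]_n,
    (forall x : 'rV[rat]_n, Q (x *m P) = \sum_(i < n) d 0 i * x 0 i ^+ 2) /\
    #|[set i : 'I_n | 0 < d 0 i]| = r /\ #|[set i : 'I_n | d 0 i < 0]| = s.

Definition qst (m : nat) (e : 'I_m -> bool) (z : 'rV[rat]_m) : rat :=
  \sum_(i < m) (if e i then 1 else -1) * z 0 i ^+ 2.

Definition isometric_embedding (n m : nat) (Q1 : 'rV[rat]_n -> rat)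
    (Q2 : 'rV[rat]_m -> rat) (M : 'M[rat]_(n, m)) : Prop :=
  row_free M /\ forall x : 'rV[rat]_n, Q2 (x *m M) = Q1 x.

(* Main.v *)
(** Diagonalising, the form of the lattice is [<d_1, ..., d_n>], and the target
    is [<e_1, ..., e_n, a, b, c>] with [e_i] the sign of [d_i] and [a, b, c]
    equal to [1] or [-1].  It is enough to exchange one sign for one [d_i] at a
    time: if [<e, a, b, c>] represents [d], where [e] is the sign of [d], then
    [<e, a, b, c>] is isometric to [<d, a', b', c'>], and the next step starts
    from arbitrary nonzero [a', b', c'].  Up to a global sign, [e = 1] and
    [d > 0].  Then [<1, a, b, c>] represents [d] as soon as there are nonzero
    [t] and [u] such that [<1, a>] represents [t], [<b, c>] represents [u] and
    [<t, u>] represents [d]; by Legendre's theorem these are conditions on the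
    three Hilbert symbols [(-a, t)], [(-bc, ub)] and [(-tu, td)].  Such [t] and
    [u] exist locally (a finite check on square classes), and Dirichlet's
    theorem for quadratic characters realises the local data by integers, each
    with a single auxiliary prime, where the symbol vanishes by the product
    formula. *)

Require Import Defs.
From HB Require Import structures.
From mathcomp Require Import all_boot all_order all_algebra all_field.
From mathcomp Require Import reals sequences exp Rstruct.
From mathcomp Require Import zify ring lra.
Set Implicit Arguments. Unset Strict Implicit. Unset Printing Implicit Defensive.
Import Order.TTheory GRing.Theory Num.Theory.
Local Open Scope ring_scope.

(** * Quadratic reciprocity *)

(** Three extra coordinates are what makes an exchange unconditional at the finite places:
    [<e, a, b, c, -d>] has five variables, hence is isotropic over every Q_p, and the equal signs of
    e and d settle the real place. Isotropy over Q is not drawn from a general local-global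
    principle for five variables. Inserting t and u cuts the question into ternary forms, the range
    of Legendre's descent, and moves the difficulty into finding t and u. Taking t > 0 and u of the
    sign of b trivialises all real symbols. The obstacle is the auxiliary prime q of t: it is a new
    bad place of the third condition, and the class of t there is unknown. Giving u the class of d
    at q turns that symbol into (-td, td), which is always trivial. The prescribed data are square
    classes, that is, values of real characters, so Dirichlet's theorem is needed for real
    characters only, and the nonvanishing of their L-series at 1 has an elementary proof by
    inequalities. *)

Definition nonres (p : nat) (x : int) : bool := (x%:~R ^+ p.-1./2 == -1 :> 'F_p).

Section OddPrime.
Variable p : nat.
Hypotheses (pr_p : prime p) (odd_p : odd p).

Lemma Fp_intr_eq0 (x : int) : (x%:~R == 0 :> 'F_p) = (p %| `|x|)%N.
Proof.
have H (n : nat) : (n%:R == 0 :> 'F_p) = (p %| n)%N.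
  by rewrite (dvdn_pcharf (pchar_Fp pr_p)).
case: x => n; first by rewrite -pmulrn H.
by rewrite NegzE mulrNz oppr_eq0 -pmulrn H abszN.
Qed.

Lemma Fp_N1_neq1 : (-1 == 1 :> 'F_p) = false.
Proof.
rewrite eq_sym -subr_eq0 opprK -[1 + 1]/(2%:~R) Fp_intr_eq0.
by apply/negP => /dvdn_leq /= /(_ isT); move: (prime_gt1 pr_p) odd_p; case: (p) => [|[|[|]]].
Qed.

Lemma Fp_fermat (x : 'F_p) : x != 0 -> x ^+ p.-1 = 1.
Proof.
move=> x0; apply: (mulfI x0); rewrite mulr1 -exprS prednK ?prime_gt0 //.
by rewrite -[X in x ^+ X](card_Fp pr_p) expf_card.
Qed.

Lemma odd_prime_half : p.-1 = (p.-1./2).*2.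
Proof. by rewrite -[LHS]odd_double_half; move: odd_p (prime_gt0 pr_p); case: (p) => //= k /negbTE->. Qed.

(** [nonres] is the Legendre symbol, defined by Euler's criterion and written additively. By Fermat
    the power squares to 1, so it is a sign and multiplicativity is immediate; actual squares enter
    only in [nonres_sqr]. *)
Lemma nonres_expE (x : int) : ~~ (p %| `|x|)%N -> x%:~R ^+ p.-1./2 = (-1) ^+ nonres p x :> 'F_p.
Proof.
move=> xp; rewrite /nonres; case: (boolP (_ == -1)) => [/eqP -> //|].
have := @Fp_fermat (x%:~R); rewrite Fp_intr_eq0 => /(_ xp).
rewrite {1}odd_prime_half -muln2 exprM => /eqP; rewrite sqrf_eq1 => /orP[] /eqP -> //.
by rewrite eqxx.
Qed.

Lemma nonresM (x y : int) : ~~ (p %| `|x|)%N -> ~~ (p %| `|y|)%N -> nonres p (x * y) = nonres p x (+) nonres p y.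
Proof.
move=> xp yp; rewrite {1}/nonres intrM exprMn !nonres_expE // -signr_addb.
by case: (_ (+) _); rewrite ?expr1 ?eqxx // eq_sym Fp_N1_neq1.
Qed.

Lemma nonres_mod (x y : int) : (p %| `|x - y|)%N -> nonres p x = nonres p y.
Proof.
by move=> h; rewrite /nonres; suff -> : x%:~R = y%:~R :> 'F_p by []; apply/eqP; rewrite -subr_eq0 -intrB Fp_intr_eq0.
Qed.

Lemma nonres_eqsgn (x : int) (b : bool) : x%:~R ^+ p.-1./2 = (-1) ^+ b :> 'F_p -> nonres p x = b.
Proof. by rewrite /nonres => ->; case: b; rewrite ?expr1 ?eqxx // expr0 eq_sym Fp_N1_neq1. Qed.

Lemma nonres1 : nonres p 1 = false.
Proof. by apply: nonres_eqsgn; rewrite expr1n. Qed.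

Lemma nonresN1 : nonres p (-1) = odd p.-1./2.
Proof. by apply: nonres_eqsgn; rewrite signr_odd. Qed.

(** Degree bound on the roots of X^m - a. With a = 1 it serves twice: it leaves room for a
    nonresidue, and it shows that the m nonzero squares are all the roots. *)
Lemma root_count (a : 'F_p) : a != 0 -> (#|[set x : 'F_p | x ^+ p.-1./2 == a]| <= p.-1./2)%N.
Proof.
move=> a0; set m := _./2; have m0 : (0 < m)%N.
  rewrite /m; move: (prime_gt1 pr_p) odd_p; case: (p) => [|[|[|]]] //.
have := @max_poly_roots _ ('X^m - a%:P) (enum [set x : 'F_p | x ^+ m == a]).
rewrite -size_poly_eq0 size_XnsubC // => /(_ isT); rewrite -cardE ltnS; apply; last by rewrite enum_uniq.
by apply/allP => x; rewrite mem_enum inE /root !hornerE subr_eq0.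
Qed.

Lemma nonres_exists : exists n : nat, ~~ (p %| n)%N && nonres p n.
Proof.
pose A := [set x : 'F_p | x ^+ p.-1./2 == 1].
have [x] : exists x : 'F_p, x \notin ((0%R : 'F_p) |: A).
  apply/existsP; rewrite -negb_forall; apply/negP => /forallP h.
  have : (#|(0%R : 'F_p) |: A| = p)%N.
    rewrite -[RHS](card_Fp pr_p) -cardsT; congr #|pred_of_set _|.
    by apply/setP => x; rewrite [RHS]inE; apply/idP.
  have := @root_count 1 (oner_neq0 _); rewrite -/A cardsU1 => h1 h2.
  have : (p <= 1 + p.-1./2)%N by rewrite -[X in (X <= _)%N]h2 leq_add // leq_b1.
  have := prime_gt1 pr_p; move: odd_p; clear; lia.
rewrite !inE negb_or => /andP[x0 x1]; exists (nat_of_ord x).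
have xE : (nat_of_ord x)%:Z%:~R = x by rewrite -pmulrn natr_Zp.
have xp : ~~ (p %| `|(nat_of_ord x)%:Z|)%N by rewrite -Fp_intr_eq0 xE.
rewrite xp /=; have := nonres_expE xp; rewrite xE; case: nonres => // h; by rewrite h eqxx in x1.
Qed.

(** Converse of Euler's criterion by counting: the squares of 1, ..., m are distinct roots of X^m -
    1, hence all of them. *)
Lemma nonres_sqr (x : int) : ~~ (p %| `|x|)%N -> nonres p x = false -> exists w : int, (p %| `|w ^+ 2 - x|)%N.
Proof.
move=> xp hx; pose m := p.-1./2.
pose sq := fun i : 'I_m => ((i.+1)%:R : 'F_p) ^+ 2.
have pE : p = (m.*2).+1 by rewrite /m -odd_prime_half prednK // prime_gt0.
have small (n : nat) : (0 < n < p)%N -> (n%:R != 0 :> 'F_p).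
  move=> /andP[n0 np]; have := Fp_intr_eq0 n; rewrite -pmulrn => ->.
  by apply/negP => /dvdn_leq; rewrite n0 => /(_ isT) /=; rewrite leqNgt np.
have inj : injective sq.
  move=> i j /eqP; rewrite /sq eqf_sqr => h; apply/val_inj => /=.
  have [hi hj] := (ltn_ord i, ltn_ord j).
  wlog ij : i j h hi hj / (i <= j)%N.
    by move=> W; case: (leqP i j) => [|/ltnW]; [exact: W | move=> ji; apply/esym; apply: W => //;
      move: h => /orP[/eqP->|/eqP->]; rewrite ?eqxx // opprK eqxx orbT].
  case/orP: h => /eqP h.
    have : ((j - i)%N%:R == 0 :> 'F_p).
      by rewrite -subSS natrB // h subrr.
    move: ij; rewrite leq_eqVlt => /orP[/eqP //|ij]; rewrite (negbTE (small _ _)) //; lia.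
  have : ((i.+1 + j.+1)%N%:R == 0 :> 'F_p) by rewrite natrD h addNr.
  rewrite (negbTE (small _ _)) //; lia.
have sub : [set sq i | i in 'I_m] \subset [set y : 'F_p | y ^+ p.-1./2 == 1].
  apply/subsetP => y /imsetP[i _ ->]; rewrite inE /sq -exprM mul2n -odd_prime_half Fp_fermat //.
  apply: small; have := ltn_ord i; lia.
have : [set sq i | i in 'I_m] = [set y : 'F_p | y ^+ p.-1./2 == 1].
  apply/eqP; rewrite eqEcard sub card_imset // card_ord; exact: root_count (oner_neq0 _).
move/setP/(_ x%:~R); rewrite [in RHS]inE nonres_expE // hx eqxx => /imsetP[i _ h].
exists (i.+1)%:Z; rewrite -Fp_intr_eq0 intrB subr_eq0 h /sq; apply/eqP.
by rewrite rmorphXn /= -pmulrn.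
Qed.

End OddPrime.

Section GaussLemma.
Variables (p a : nat).
Hypotheses (pr_p : prime p) (odd_p : odd p) (a_p : ~~ (p %| a)%N).
Let m := p.-1./2.
(** Ordinals start at 0, hence [i.+1]. [s i] is the absolute value of the residue of a(i + 1) in
    (-p/2, p/2); these values permute 1, ..., m, which [t] below expresses on ordinals. *)
Let r (i : nat) := (a * i.+1 %% p)%N.
Let s (i : nat) := if (m < r i)%N then (p - r i)%N else r i.

Let pE : p = (m.*2).+1.
Proof. by rewrite /m -odd_prime_half // prednK // prime_gt0. Qed.

Let r_gt0 (i : 'I_m) : (0 < r i)%N.
Proof.
rewrite lt0n; apply/negP => /eqP h; have : (p %| a * i.+1)%N by apply/eqP.
rewrite Euclid_dvdM // (negbTE a_p) /= => /dvdn_leq => /(_ isT).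
by have := ltn_ord i; move: pE; lia.
Qed.

Let s_bound (i : 'I_m) : (0 < s i <= m)%N.
Proof.
rewrite /s; have := r_gt0 i; have := ltn_pmod (a * i.+1) (prime_gt0 pr_p); rewrite -/(r i).
by case: ifP; move: pE; lia.
Qed.

Let small (n : nat) : (0 < n < p)%N -> (n%:R != 0 :> 'F_p).
Proof.
move=> /andP[n0 np]; have := Fp_intr_eq0 pr_p n; rewrite -pmulrn => ->.
by apply/negP => /dvdn_leq; rewrite n0 => /(_ isT) /=; rewrite leqNgt np.
Qed.

Let rE i : (r i)%:R = a%:R * i.+1%:R :> 'F_p.
Proof. by rewrite /r Fp_nat_mod // natrM. Qed.

Let sE (i : 'I_m) : a%:R * i.+1%:R = (-1) ^+ (m < r i)%N * (s i)%:R :> 'F_p.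
Proof.
rewrite -rE /s; case: ifP => _; last by rewrite mul1r.
rewrite natrB; last by rewrite ltnW // ltn_pmod // prime_gt0.
by rewrite pchar_Fp_0 // expr1 sub0r mulN1r opprK.
Qed.

Let t (i : 'I_m) : 'I_m := insubd i (s i).-1.
Let tE (i : 'I_m) : (t i).+1 = s i :> nat.
Proof.
by have := s_bound i; rewrite /t val_insubd; case: ifP; lia.
Qed.

Let t_inj : injective t.
Proof.
move=> i j tij; have sij : s i = s j by rewrite -!tE tij.
have aU : (a%:R != 0 :> 'F_p) by have := Fp_intr_eq0 pr_p a; rewrite -pmulrn => ->.
have [hi hj] := (ltn_ord i, ltn_ord j); have := pE => pE'.
have [h|h] : (i.+1%:R = j.+1%:R :> 'F_p) \/ (i.+1%:R = - j.+1%:R :> 'F_p).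
- have si := sE i; have sj := sE j; rewrite sij in si.
  have : (i.+1%:R == j.+1%:R :> 'F_p) || (i.+1%:R == - j.+1%:R :> 'F_p).
    rewrite -eqf_sqr; apply/eqP/(mulfI (expf_neq0 2 aU)); rewrite -!exprMn si sj.
    by rewrite !exprMn !sqrr_sign.
  by case/orP => /eqP; [left|right].
- apply/val_inj => /=; wlog ij : i j h hi hj {tij sij} / (i <= j)%N.
    by move=> W; case: (leqP i j) => [|/ltnW]; [exact: W | move=> ji; apply/esym; apply: W].
  have : ((j - i)%N%:R == 0 :> 'F_p) by rewrite -subSS natrB // h subrr.
  by move: ij; rewrite leq_eqVlt => /orP[/eqP //|ij]; rewrite (negbTE (small _)) //; lia.
have : ((i.+1 + j.+1)%N%:R == 0 :> 'F_p) by rewrite natrD h addNr.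
by rewrite (negbTE (small _)) //; lia.
Qed.

(** The product of the a(i + 1) is a^m m!, and also m! times one sign for each residue beyond m,
    because [t] is a permutation. The factor m! is invertible. *)
Lemma gauss_lemma : nonres p a = odd (\sum_(i < m) (m < a * i.+1 %% p)%N).
Proof.
apply: nonres_eqsgn => //; rewrite -/m -pmulrn signr_odd.
have nz : \prod_(i < m) i.+1%:R != 0 :> 'F_p.
  by apply/prodf_neq0 => i _; apply: small; have := ltn_ord i; move: pE; lia.
apply: (mulIf nz).
transitivity (\prod_(i < m) (a%:R * i.+1%:R) : 'F_p).
  by rewrite big_split /= prodr_const card_ord.
rewrite (eq_bigr _ (fun i _ => sE i)) big_split /= -/m.
congr (_ * _); first by rewrite -expr_sum.
by rewrite [RHS](reindex_inj t_inj) /=; apply: eq_bigr => i _; rewrite tE.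
Qed.

(** As p is odd, a(i + 1) has the parity of its quotient plus [s i] plus the indicator of m < r i.
    In the sum over i the [s i] add up to the sum of the i + 1, and the two cancel because a is
    odd. *)
Lemma eisenstein_lemma : odd a -> nonres p a = odd (\sum_(i < m) (a * i.+1 %/ p)).
Proof.
move=> odd_a; rewrite gauss_lemma.
have H (F G : 'I_m -> nat) : (forall i, odd (F i) = odd (G i)) -> odd (\sum_i F i) = odd (\sum_i G i).
  move=> FG; elim/big_ind2: _ => //= x1 x2 y1 y2; rewrite !oddD => -> -> //.
have e1 : \sum_(i < m) (i.+1) = \sum_(i < m) s i :> nat.
  by rewrite (reindex_inj t_inj) /=; apply: eq_bigr => i _; rewrite tE.
have := H (fun i => a * i.+1)%N (fun i => (a * i.+1 %/ p) + (s i + (m < r i)))%N.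
rewrite big_split /= big_split /= -e1 => /(_ _)/wrap[].
  move=> i; rewrite {1}(divn_eq (a * i.+1) p) -/(r i) oddD oddM odd_p andbT [RHS]oddD; congr (_ (+) _).
  rewrite /s; case: ifP => // _; last by rewrite addn0.
  rewrite oddD oddB ?odd_p; last by rewrite ltnW // ltn_pmod // prime_gt0.
  by rewrite addTb addbT negbK.
by rewrite -big_distrr /= oddM odd_a /= !oddD; do 3!case: (odd _).
Qed.

End GaussLemma.

(** Eisenstein's lattice points: the two sums of quotients count the points of an m by k rectangle
    on either side of the diagonal, and no point lies on it. *)
Lemma quadratic_reciprocity (p q : nat) : prime p -> prime q -> odd p -> odd q -> p != q ->
  nonres p q (+) nonres q p = odd (p.-1./2 * q.-1./2).
Proof.
move=> pr_p pr_q odd_p odd_q pq.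
have npq : ~~ (p %| q)%N by rewrite dvdn_prime2.
have nqp : ~~ (q %| p)%N by rewrite dvdn_prime2 // eq_sym.
rewrite !eisenstein_lemma // -oddD; congr odd.
set m := p.-1./2; set k := q.-1./2.
have pE : p = (m.*2).+1 by rewrite /m -odd_prime_half // prednK // prime_gt0.
have qE : q = (k.*2).+1 by rewrite /k -odd_prime_half // prednK // prime_gt0.
(* Keeps each column inside the rectangle: q(i + 1) < (k + 1)p, and symmetrically. *)
have bnd (u v i : nat) : (i < u)%N -> ((v.*2).+1 * i.+1 < v.+1 * (u.*2).+1)%N.
  move=> iu; have : ((v.*2).+1 * i.+1 <= (v.*2).+1 * u)%N by rewrite leq_mul.
  have -> : ((v.*2).+1 * u = (v * u).*2 + u)%N by lia.
  have -> : (v.+1 * (u.*2).+1 = (v * u).*2 + v + u.*2 + 1)%N by lia.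
  lia.
have floor_sum (n u b : nat) : (0 < u)%N -> (b %/ u <= n)%N ->
    (b %/ u = \sum_(j < n) (u * j.+1 <= b))%N.
  move=> u0 h; rewrite -(subnKC h) big_split_ord /=.
  rewrite (eq_bigr (fun=> 1%N)) ?sum1_card ?card_ord.
    rewrite big1 ?addn0 // => i _; apply/eqP; rewrite eqb0 -ltnNge mulnC -ltn_divLR //; lia.
  by move=> i _; rewrite mulnC -leq_divRL // ltn_ord.
rewrite (eq_bigr (fun i : 'I_m => \sum_(j < k) (p * j.+1 <= q * i.+1))%N); last first.
  move=> i _; apply: floor_sum; first exact: prime_gt0.
  by rewrite -ltnS ltn_divLR ?prime_gt0 // pE qE; apply: bnd.
rewrite [X in (_ + X)%N](eq_bigr (fun j : 'I_k => \sum_(i < m) (q * i.+1 <= p * j.+1))%N); last first.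
  move=> i _; apply: floor_sum; first exact: prime_gt0.
  by rewrite -ltnS ltn_divLR ?prime_gt0 // pE qE; apply: bnd.
rewrite [X in (_ + X)%N]exchange_big /= -big_split /= -[m in RHS]card_ord -sum_nat_const.
apply: eq_bigr => i _; rewrite -big_split /= -[k in RHS]card_ord -sum1_card.
apply: eq_bigr => j _.
have : (p * j.+1 != q * i.+1)%N.
  apply/eqP => h; have : (p %| q * i.+1)%N by rewrite -h dvdn_mulr.
  rewrite Euclid_dvdM // (negbTE npq) => /dvdn_leq /= /(_ isT); have := ltn_ord i; lia.
case: ltngtP => //.
Qed.

(** Gauss's lemma without reduction, since 2(i + 1) < p: the exponent is [m - m./2], whose parity
    depends on p modulo 8. *)
Lemma nonres2 (p : nat) : prime p -> odd p -> nonres p 2 = ((p %% 8 == 3) || (p %% 8 == 5))%N.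
Proof.
move=> pr_p odd_p.
have n2 : ~~ (p %| 2)%N.
  by apply/negP => /dvdn_leq => /(_ isT); move: (prime_gt1 pr_p) odd_p; case: (p) => [|[|[|]]].
rewrite (@gauss_lemma p 2) //; set m := _./2.
have pE : p = (m.*2).+1 by rewrite /m -odd_prime_half // prednK // prime_gt0.
rewrite (eq_bigr (fun i : 'I_m => (m./2 <= i) : nat)%N); last first.
  by move=> i _; have := ltn_ord i => h; have -> : (m < (2 * i.+1) %% p)%N = (m./2 <= i)%N by rewrite modn_small; lia.
have count (c k : nat) : (\sum_(i < k) (c <= i) = k - c)%N.
  by elim: k => [|k IH]; rewrite ?big_ord0 // big_ord_recr /= IH; lia.
rewrite count; lia.
Qed.

(** * Hilbert symbols and the product formula *)

Definition unit_part (p : nat) (x : int) : int := sgz x * (`|x|`_p^')%N%:Z.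
Definition val_odd (p : nat) (x : int) : bool := odd (logn p `|x|).
Definition res_bit (p : nat) (x : int) : bool := nonres p (unit_part p x).
(** [eps2] and [omega2] are the classical exponents (u - 1)/2 and (u^2 - 1)/8 modulo 2 of the unit
    part u. *)
Definition eps2 (x : int) : bool := (unit_part 2 x %% 4 == 3)%Z.
Definition omega2 (x : int) : bool :=
  ((unit_part 2 x %% 8 == 3) || (unit_part 2 x %% 8 == 5))%Z.

(* The symbols are written additively, [true] standing for -1, and are meaningful
   for nonzero arguments only. *)
Definition hilbert (p : nat) (a b : int) : bool :=
  (val_odd p a && val_odd p b && nonres p (-1)) (+) (val_odd p a && res_bit p b)
  (+) (val_odd p b && res_bit p a).
Definition hilbert2 (a b : int) : bool :=
  (eps2 a && eps2 b) (+) (val_odd 2 a && omega2 b) (+) (val_odd 2 b && omega2 a).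
Definition hilbert_oo (a b : int) : bool := (a < 0) && (b < 0).

Lemma unit_partM p x y : x != 0 -> y != 0 -> unit_part p (x * y) = unit_part p x * unit_part p y.
Proof. by move=> x0 y0; rewrite /unit_part sgzM abszM partnM ?absz_gt0 // PoszM mulrACA. Qed.

Lemma absz_unit_part p x : x != 0 -> `|unit_part p x|%N = (`|x|`_p^')%N.
Proof. by move=> x0; rewrite /unit_part abszM absz_nat; case: sgzP x0 => //= *; rewrite mul1n. Qed.

Lemma unit_part_ndvd p x : prime p -> x != 0 -> ~~ (p %| `|unit_part p x|)%N.
Proof.
move=> pr_p x0; rewrite absz_unit_part //.
have := @part_pnat p^' `|x|; rewrite p'natE //.
Qed.

Lemma unit_part_id p x : prime p -> x != 0 -> ~~ (p %| `|x|)%N -> unit_part p x = x.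
Proof.
move=> pr_p x0 px; rewrite /unit_part part_pnat_id; first by rewrite -intEsg.
by rewrite p'natE.
Qed.

Lemma unit_part_pfactor p : prime p -> unit_part p p = 1.
Proof.
move=> pr_p; rewrite /unit_part /=; have := partnC p (prime_gt0 pr_p).
rewrite part_pnat_id ?pnat_id // => h.
rewrite gtr0_sgz ?ltz_nat ?prime_gt0 // mul1r.
by have /eqP := h; rewrite -[X in _ == X]muln1 eqn_pmul2l ?prime_gt0 // => /eqP ->.
Qed.

Lemma val_oddM p x y : x != 0 -> y != 0 -> val_odd p (x * y) = val_odd p x (+) val_odd p y.
Proof. by move=> x0 y0; rewrite /val_odd abszM lognM ?absz_gt0 // oddD. Qed.

Lemma val_odd_ndvd p x : ~~ (p %| `|x|)%N -> val_odd p x = false.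
Proof.
rewrite /val_odd => px; case: (posnP (logn p `|x|)) => [-> //|].
by rewrite logn_gt0 mem_primes => /and3P[_ _ h]; rewrite h in px.
Qed.

Lemma val_odd_prime p : prime p -> val_odd p p.
Proof. by move=> pr_p; rewrite /val_odd /= logn_prime // eqxx. Qed.

Lemma res_bitM p x y : prime p -> odd p -> x != 0 -> y != 0 ->
  res_bit p (x * y) = res_bit p x (+) res_bit p y.
Proof. by move=> pr_p odd_p x0 y0; rewrite /res_bit unit_partM // nonresM ?unit_part_ndvd. Qed.

Lemma unit_part2_mod8 x : x != 0 ->
  [\/ (unit_part 2 x %% 8 = 1)%Z, (unit_part 2 x %% 8 = 3)%Z, (unit_part 2 x %% 8 = 5)%Z | (unit_part 2 x %% 8 = 7)%Z].
Proof.
move=> x0; have := @unit_part_ndvd 2 x isT x0.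
move: (unit_part 2 x) => u; rewrite dvdn2 negbK => h.
have : (u %% 8 = 1 \/ u %% 8 = 3 \/ u %% 8 = 5 \/ u %% 8 = 7)%Z by lia.
by case=> [->|[->|[->|->]]]; [constructor 1|constructor 2|constructor 3|constructor 4].
Qed.

Lemma eps2M x y : x != 0 -> y != 0 -> eps2 (x * y) = eps2 x (+) eps2 y.
Proof.
move=> x0 y0; rewrite /eps2 unit_partM //.
have := unit_part2_mod8 x0; have := unit_part2_mod8 y0.
move: (unit_part 2 x) (unit_part 2 y) => u v hv hu.
have mod4 (w : int) : modz w 4 = modz (modz w 8) 4 by lia.
rewrite (mod4 (u * v)) (mod4 u) (mod4 v) -modzMm.
by case: hu => ->; case: hv => ->.
Qed.

Lemma omega2M x y : x != 0 -> y != 0 -> omega2 (x * y) = omega2 x (+) omega2 y.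
Proof.
move=> x0 y0; rewrite /omega2 unit_partM //.
have := unit_part2_mod8 x0; have := unit_part2_mod8 y0.
move: (unit_part 2 x) (unit_part 2 y) => u v hv hu.
rewrite -modzMm.
by case: hu => ->; case: hv => ->.
Qed.

Lemma ltz0M (x y : int) : x != 0 -> y != 0 -> (x * y < 0) = (x < 0) (+) (y < 0).
Proof. nia. Qed.

Lemma hilbertC p a b : hilbert p a b = hilbert p b a.
Proof. by rewrite /hilbert; do 2!case: (val_odd _ _); do 2!case: (res_bit _ _); case: (nonres _ _). Qed.
Lemma hilbert2C a b : hilbert2 a b = hilbert2 b a.
Proof. by rewrite /hilbert2 [eps2 a && _]andbC addbAC. Qed.
Lemma hilbert_ooC a b : hilbert_oo a b = hilbert_oo b a.
Proof. by rewrite /hilbert_oo andbC. Qed.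

Lemma hilbertMl p a b c : prime p -> odd p -> a != 0 -> b != 0 ->
  hilbert p (a * b) c = hilbert p a c (+) hilbert p b c.
Proof.
move=> pr_p odd_p a0 b0; rewrite /hilbert val_oddM // res_bitM //.
by do 3!case: (val_odd _ _); do 3!case: (res_bit _ _); case: (nonres _ _).
Qed.

Lemma hilbert2Ml a b c : a != 0 -> b != 0 -> hilbert2 (a * b) c = hilbert2 a c (+) hilbert2 b c.
Proof.
move=> a0 b0; rewrite /hilbert2 val_oddM // eps2M // omega2M //.
by do 3!case: (val_odd _ _); do 3!case: (eps2 _); do 3!case: (omega2 _).
Qed.

Lemma hilbert_ooMl a b c : a != 0 -> b != 0 ->
  hilbert_oo (a * b) c = hilbert_oo a c (+) hilbert_oo b c.
Proof. by move=> a0 b0; rewrite /hilbert_oo ltz0M // andb_addl. Qed.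

(** Finite form of the sum over all places: once [B] exceeds both nonzero arguments in absolute
    value, odd primes from [B] on have trivial symbol. *)
Definition hilbert_sum (B : nat) (a b : int) : bool :=
  \big[addb/false]_(p < B | prime p && odd p) hilbert p a b (+) hilbert2 a b (+) hilbert_oo a b.

Lemma hilbert_sumC B a b : hilbert_sum B a b = hilbert_sum B b a.
Proof.
rewrite /hilbert_sum hilbert2C hilbert_ooC; congr (_ (+) _ (+) _).
by apply: eq_bigr => p _; rewrite hilbertC.
Qed.

Lemma hilbert_sumMl B a b c : a != 0 -> b != 0 ->
  hilbert_sum B (a * b) c = hilbert_sum B a c (+) hilbert_sum B b c.
Proof.
move=> a0 b0; rewrite /hilbert_sum hilbert2Ml // hilbert_ooMl //.
rewrite (eq_bigr (fun p : 'I_B => hilbert p a c (+) hilbert p b c)); last first.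
  by move=> p /andP[pr_p odd_p]; rewrite hilbertMl.
rewrite big_split /=; move: (\big[_/_]_(_ < B | _) _) (\big[_/_]_(_ < B | _) _) => u v.
by case: u; case: v; do 2!case: (hilbert2 _ _); do 2!case: (hilbert_oo _ _).
Qed.

(** A homomorphism to Z/2 is determined by -1 and the primes. The bound is carried along because
    [hilbert_sum B] is known to vanish only at primes below [B]. *)
Lemma int_mul_ind (B : nat) (F : int -> bool) :
  (forall x y, x != 0 -> y != 0 -> F (x * y) = F x (+) F y) ->
  F (-1) = false -> (forall p, prime p -> (p < B)%N -> F p = false) ->
  forall x, x != 0 -> (`|x| < B)%N -> F x = false.
Proof.
move=> FM FN1 Fp.
have F1 : F 1 = false by have := FM 1 1 isT isT; rewrite mulr1; case: (F 1).
have Fn (n : nat) : (0 < n < B)%N -> F n = false.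
  elim/ltn_ind: n => n IH /andP[n0 nB].
  have [n1|n1] := leqP n 1; first by have -> : n = 1%N by lia.
  have pr := pdiv_prime n1; have dv := pdiv_dvd n.
  rewrite -(divnK dv) PoszM FM.
  - have q0 : (0 < n %/ pdiv n)%N by rewrite divn_gt0 ?pdiv_gt0 // pdiv_leq // ltnW.
    have ql : (n %/ pdiv n < n)%N by rewrite ltn_Pdiv // prime_gt1.
    by rewrite IH // ?q0 ?(ltn_trans ql) // Fp // (leq_ltn_trans _ nB) // pdiv_leq.
  - have q0 : (0 < n %/ pdiv n)%N by rewrite divn_gt0 ?pdiv_gt0 // pdiv_leq // ltnW.
    by rewrite -lt0n.
  - by rewrite -lt0n pdiv_gt0.
move=> x x0 xB; have sx : sgz x != 0 by rewrite sgz_eq0.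
have ax : (`|x|%N)%:Z != 0 by lia.
rewrite [x]intEsg FM // Fn ?absz_gt0 ?x0 // addbF.
by case: sgzP x0.
Qed.

Lemma eps2_odd (p : nat) : prime p -> odd p -> eps2 p = (p %% 4 == 3)%N.
Proof.
move=> pr_p odd_p; have p0 : p%:Z != 0 by rewrite -lt0n prime_gt0.
rewrite /eps2 unit_part_id //; first lia.
by rewrite dvdn2 absz_nat odd_p.
Qed.

Lemma omega2_odd (p : nat) : prime p -> odd p -> omega2 p = ((p %% 8 == 3) || (p %% 8 == 5))%N.
Proof.
move=> pr_p odd_p; have p0 : p%:Z != 0 by rewrite -lt0n prime_gt0.
rewrite /omega2 unit_part_id //; first lia.
by rewrite dvdn2 absz_nat odd_p.
Qed.

Lemma val_odd2_odd (p : nat) : odd p -> val_odd 2 p = false.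
Proof. by move=> odd_p; apply: val_odd_ndvd; rewrite dvdn2 absz_nat odd_p. Qed.

Lemma eps2N1 : eps2 (-1) = true. Proof. by rewrite /eps2 /unit_part /= partn1. Qed.
Lemma omega2N1 : omega2 (-1) = false. Proof. by rewrite /omega2 /unit_part /= partn1. Qed.
Lemma val_oddN1 p : val_odd p (-1) = false. Proof. by rewrite /val_odd /= logn1. Qed.
Lemma res_bitN1 p : res_bit p (-1) = nonres p (-1).
Proof. by rewrite /res_bit /unit_part /= partn1. Qed.
Lemma eps22 : eps2 2 = false. Proof. by rewrite /eps2 (@unit_part_pfactor 2). Qed.

Lemma nonresN1_mod4 p : prime p -> odd p -> nonres p (-1) = (p %% 4 == 3)%N.
Proof. by move=> pr_p odd_p; rewrite nonresN1 //; lia. Qed.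

Lemma hilbert_unit p a b : ~~ (p %| `|a|)%N -> ~~ (p %| `|b|)%N -> hilbert p a b = false.
Proof. by move=> pa pb; rewrite /hilbert !val_odd_ndvd. Qed.

Lemma big_addb_single B (F : nat -> bool) p : prime p -> odd p -> (p < B)%N ->
  (forall l, prime l -> odd l -> l != p -> F l = false) ->
  \big[addb/false]_(l < B | prime l && odd l) F l = F p.
Proof.
move=> pr_p odd_p pB h; rewrite (bigD1 (Ordinal pB)) /=; last by rewrite pr_p.
rewrite big1 ?addbF // => l /andP[/andP[pl ol]] /eqP lp; apply: h => //.
by apply/eqP => lp'; apply: lp; apply/val_inj.
Qed.

Lemma prime_ndvd (p l : nat) : prime p -> prime l -> l != p -> ~~ (l %| `|p%:Z|)%N.
Proof. by move=> pr_p pr_l lp; rewrite absz_nat dvdn_prime2. Qed.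

Lemma prime_ndvdN1 (l : nat) : prime l -> ~~ (l %| `|-1 : int|)%N.
Proof. by move=> pr_l; rewrite abszN1 dvdn1; case: eqP pr_l => // ->. Qed.

Lemma hilbert_sum_N1N1 B : hilbert_sum B (-1) (-1) = false.
Proof.
rewrite /hilbert_sum big1 => [|l _]; last by rewrite /hilbert !val_oddN1.
by rewrite /hilbert2 /hilbert_oo eps2N1 val_oddN1.
Qed.

(** First supplementary law: for odd p, the places p and 2 both contribute the bit of p = 3 mod
    4. *)
Lemma hilbert_sum_N1p B p : prime p -> (p < B)%N -> hilbert_sum B p (-1) = false.
Proof.
move=> pr_p pB; rewrite /hilbert_sum /hilbert_oo ltz_nat /= addbF.
have [p2|odd_p] := even_prime pr_p.
  rewrite p2 big1 => [|l /andP[pr_l odd_l]].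
    by rewrite /hilbert2 eps22 omega2N1 val_oddN1 andbF.
  apply: hilbert_unit; last exact: prime_ndvdN1.
  by apply: (@prime_ndvd 2) => //; case: eqP odd_l => // ->.
rewrite (@big_addb_single _ (fun l => hilbert l p (-1)) p) //.
  rewrite /hilbert /hilbert2 val_odd_prime // !val_oddN1 val_odd2_odd // res_bitN1 eps2N1.
  by rewrite nonresN1_mod4 // eps2_odd //=; case: (_ == _).
move=> l pr_l odd_l lp; apply: hilbert_unit; first exact: prime_ndvd.
exact: prime_ndvdN1.
Qed.

(** The symbol (a, -a) is always trivial. This reduces (p, p) to (p, -1) in the product formula. *)
Lemma hilbert_self p a : prime p -> odd p -> a != 0 -> hilbert p a a = hilbert p a (-1).
Proof.
move=> pr_p odd_p a0; rewrite /hilbert val_oddN1 res_bitN1.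
by case: (val_odd _ _); case: (nonres _ _); case: (res_bit _ _).
Qed.

Lemma hilbert2_self (a : int) : a != 0 -> hilbert2 a a = hilbert2 a (-1).
Proof.
by move=> a0; rewrite /hilbert2 val_oddN1 eps2N1 omega2N1; case: (val_odd _ _); case: (omega2 _); case: (eps2 _).
Qed.

Lemma res_bit_prime (p q : nat) : prime p -> prime q -> p != q -> res_bit p q = nonres p q.
Proof.
by move=> pr_p pr_q pq; rewrite /res_bit unit_part_id ?absz_nat ?dvdn_prime2 // -lt0n prime_gt0.
Qed.

(** For distinct p and q only the places p, q and 2 can contribute; the identity is quadratic
    reciprocity, or the second supplementary law if one of the primes is 2. *)
Lemma hilbert_sum_pq B p q : prime p -> (p < B)%N -> prime q -> (q < B)%N ->
  hilbert_sum B p q = false.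
Proof.
move=> pr_p pB pr_q qB; have [p0 q0] : p%:Z != 0 /\ q%:Z != 0 by rewrite -!lt0n !prime_gt0.
have [pq|npq] := eqVneq p q.
  rewrite -{}pq {q pr_q qB q0}; rewrite -(hilbert_sum_N1p pr_p pB).
  rewrite /hilbert_sum hilbert2_self //; congr (_ (+) _ (+) _).
  by apply: eq_bigr => l /andP[pl ol]; rewrite hilbert_self.
wlog odd_p : p q pr_p pr_q pB qB p0 q0 npq / odd p.
  move=> W; have [p2|/W] := even_prime pr_p; last exact.
  have [q2|odd_q] := even_prime pr_q; first by rewrite p2 q2 in npq.
  by rewrite hilbert_sumC; apply: W => //; rewrite eq_sym.
rewrite /hilbert_sum /hilbert_oo ltz_nat /= addbF.
rewrite (bigD1 (Ordinal pB)) /=; last by rewrite pr_p.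
rewrite {1}/hilbert val_odd_prime // (@val_odd_ndvd p q) ?(@res_bit_prime p q) //; last exact: prime_ndvd.
rewrite andbF /= addbF.
have [q2|odd_q] := even_prime pr_q.
  rewrite big1 ?addbF => [|l /andP[/andP[pl ol] lp]]; last first.
    apply: hilbert_unit; apply: prime_ndvd => //.
    by rewrite q2; case: eqP ol => // ->.
  rewrite q2 /hilbert2 eps22 andbF (val_odd2_odd odd_p) (@val_odd_prime 2) //= omega2_odd // nonres2 //.
  by case: (_ || _).
rewrite (bigD1 (Ordinal qB)) /=; last by rewrite pr_q odd_q; apply/eqP => -[qp]; rewrite qp eqxx in npq.
rewrite {1}/hilbert val_odd_prime // (@val_odd_ndvd q p) ?(@res_bit_prime q p) // 1?eq_sym //; last first.
  by apply: prime_ndvd => //; rewrite eq_sym.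
rewrite big1 ?addbF => [|l /andP[/andP[/andP[pl ol] /eqP lp] /eqP lq]]; last first.
  apply: hilbert_unit; apply: prime_ndvd => //; apply/eqP => h; [apply: lp|apply: lq]; exact: val_inj.
rewrite /= /hilbert2 !val_odd2_odd //= !addbF !eps2_odd // quadratic_reciprocity // oddM.
by rewrite -!nonresN1_mod4 // !nonresN1 // addbb.
Qed.

Theorem product_formula B a b : a != 0 -> b != 0 -> (`|a| < B)%N -> (`|b| < B)%N ->
  hilbert_sum B a b = false.
Proof.
move=> a0 b0 aB bB.
apply: (@int_mul_ind B (fun x => hilbert_sum B x b)) => //.
- by move=> x y x0 y0; apply: hilbert_sumMl.
- rewrite hilbert_sumC; apply: (@int_mul_ind B (fun x => hilbert_sum B x (-1))) => //.
  + by move=> x y x0 y0; apply: hilbert_sumMl.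
  + exact: hilbert_sum_N1N1.
  + by move=> p pr_p pB; apply: hilbert_sum_N1p.
- move=> p pr_p pB; rewrite hilbert_sumC; apply: (@int_mul_ind B (fun x => hilbert_sum B x p)) => //.
  + by move=> x y x0 y0; apply: hilbert_sumMl.
  + by rewrite hilbert_sumC hilbert_sum_N1p.
  + by move=> q pr_q qB; apply: hilbert_sum_pq.
Qed.

(** * Legendre's theorem *)

Lemma dvdz_addr (d x y : int) : (d %| x)%Z -> (d %| x + y)%Z = (d %| y)%Z.
Proof. exact: rpredDl. Qed.
Lemma dvdz_addl (d x y : int) : (d %| y)%Z -> (d %| x + y)%Z = (d %| x)%Z.
Proof. exact: rpredDr. Qed.
Lemma dvdzN (d x : int) : (d %| - x)%Z = (d %| x)%Z.
Proof. exact: rpredN. Qed.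

Definition sqfree (x : int) := forall p : nat, prime p -> ~~ (p ^ 2 %| `|x|)%N.

Lemma sqfree_or (x : int) : sqfree x \/ exists2 p : nat, prime p & exists y : int, x = p%:Z * p%:Z * y.
Proof.
have [h|h] := boolP [forall p : 'I_(`|x|.+1), prime p ==> ~~ (p ^ 2 %| `|x|)%N].
  have [->|x0] := eqVneq x 0; first by right; exists 2%N => //; exists 0; rewrite mulr0.
  left => p pr_p; have [xp|px] := ltnP `|x| p.
    apply/negP => /dvdn_leq; rewrite absz_gt0 => /(_ x0); have := prime_gt1 pr_p; nia.
  by have /forallP/(_ (Ordinal (px : (p < `|x|.+1)%N)))/implyP/(_ pr_p) := h.
right; move: h; rewrite negb_forall => /existsP[p]; rewrite negb_imply negbK => /andP[pr_p dv].
exists p => //; have : (p%:Z * p%:Z %| x)%Z by rewrite dvdzE abszM /= mulnn.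
by case/dvdzP => y xE; exists y; rewrite mulrC.
Qed.

Lemma res_bit_unit p x : prime p -> ~~ (p %| `|x|)%N -> res_bit p x = nonres p x.
Proof.
move=> pr_p px; rewrite /res_bit unit_part_id //.
by apply: contraNneq px => ->.
Qed.

Lemma nonres_square p x : prime p -> odd p -> ~~ (p %| `|x|)%N -> nonres p (x ^+ 2) = false.
Proof. by move=> pr_p odd_p px; rewrite expr2 nonresM // addbb. Qed.

(** w^2 - a is the norm of w + sqrt a. If p divides it but not a, then a is a square modulo p; if p
    divides a but not w, it is a unit congruent to w^2; if p divides both, a = p a' and the norm is
    p u with u = -a' modulo p. *)
Lemma hilbert_norm p (a w : int) : prime p -> odd p -> sqfree a -> a != 0 -> w ^+ 2 - a != 0 ->
  hilbert p a (w ^+ 2 - a) = false.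
Proof.
move=> pr_p odd_p sqf a0 n0; have p0 : p%:Z != 0 by rewrite -lt0n prime_gt0.
have [pa|pa] := boolP (p %| `|a|)%N; last first.
  rewrite /hilbert (val_odd_ndvd pa) (res_bit_unit _ pa) //=.
  have [pn|pn] := boolP (p %| `|w ^+ 2 - a|)%N; last by rewrite (val_odd_ndvd pn).
  have pw : ~~ (p %| `|w|)%N.
    apply: contra pa => pw; have : (p%:Z %| w ^+ 2 - a)%Z by rewrite dvdzE.
    by rewrite dvdz_addr ?dvdzN // expr2 dvdz_mulr // dvdzE.
  by rewrite -(nonres_mod pr_p pn) nonres_square // andbF.
have [pw|pw] := boolP (p %| `|w|)%N; last first.
  have pn : ~~ (p %| `|w ^+ 2 - a|)%N.
    apply: contra pw => pn; have : (p%:Z %| w ^+ 2 - a)%Z by rewrite dvdzE.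
    by rewrite dvdz_addl ?dvdzN // dvdzE /= abszX Euclid_dvdX // andbT.
  rewrite /hilbert (val_odd_ndvd pn) res_bit_unit // andbF /=.
  have -> : nonres p (w ^+ 2 - a) = nonres p (w ^+ 2) by apply: nonres_mod => //; rewrite addrAC subrr add0r abszN.
  by rewrite nonres_square // andbF.
have /dvdzP[a' aE] : (p%:Z %| a)%Z by rewrite dvdzE.
have /dvdzP[w' wE] : (p%:Z %| w)%Z by rewrite dvdzE.
have pa' : ~~ (p %| `|a'|)%N.
  by have := sqf p pr_p; rewrite aE abszM absz_nat mulnC -mulnn dvdn_pmul2l // prime_gt0.
have a'0 : a' != 0 by apply: contraNneq pa' => ->.
set u := p%:Z * w' ^+ 2 - a'.
have nE : w ^+ 2 - a = u * p%:Z by rewrite /u wE aE; ring.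
have pu : ~~ (p %| `|u|)%N.
  have : ~~ (p%:Z %| a')%Z by rewrite dvdzE.
  apply: contra => pu; have : (p%:Z %| u)%Z by rewrite dvdzE.
  by rewrite /u dvdz_addr ?dvdzN // dvdz_mulr.
have u0 : u != 0 by apply: contraNneq pu => ->.
rewrite /hilbert nE aE !val_oddM // !res_bitM // !val_odd_prime // !val_odd_ndvd //.
have -> : res_bit p p = false by rewrite /res_bit unit_part_pfactor // nonres1.
rewrite !res_bit_unit //.
have -> : nonres p u = nonres p (- a').
  by apply: nonres_mod => //; rewrite /u opprK subrK abszM dvdn_mulr.
rewrite -(mulN1r a') nonresM //=; last exact: prime_ndvdN1.
by case: (nonres p (-1)); case: (nonres p a').
Qed.

(** Chinese remainders over the primes of n. The prime 2 costs nothing because a^2 - a is even; this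
    is why Legendre's theorem needs no condition at 2. *)
Lemma sqrt_mod_sqfree (a : int) (n : nat) : (0 < n)%N -> sqfree n ->
  (forall p, prime p -> odd p -> (p %| n)%N -> exists w : int, (p %| `|w ^+ 2 - a|)%N) ->
  exists w : int, (n%:Z %| w ^+ 2 - a)%Z.
Proof.
elim/ltn_ind: n => n IH n0 sqf loc.
have [n1|n1] := leqP n 1; first by exists 0; have -> : n = 1%N by lia.
have pr := pdiv_prime n1; have dv := pdiv_dvd n; set p := pdiv n in pr dv.
set m := (n %/ p)%N; have nE : n = (m * p)%N by rewrite divnK.
have m0 : (0 < m)%N by move: n0; rewrite nE muln_gt0 => /andP[].
have pm : ~~ (p %| m)%N by have := sqf p pr; rewrite absz_nat nE -mulnn dvdn_pmul2r // prime_gt0.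
have [|||w1 h1] := IH m _ m0.
- by rewrite nE ltn_Pmulr // prime_gt1.
- move=> q pr_q; apply: contra (sqf q pr_q); rewrite !absz_nat nE; exact: dvdn_mulr.
- by move=> q pr_q odd_q qm; apply: loc => //; rewrite nE dvdn_mulr.
have [w2 h2] : exists w : int, (p%:Z %| w ^+ 2 - a)%Z.
  have [p2|odd_p] := even_prime pr; last by have [w hw] := loc p pr odd_p dv; exists w; rewrite dvdzE.
  exists a; rewrite p2; have -> : a ^+ 2 - a = a * (a - 1) by ring.
  by rewrite dvdzE abszM absz_nat dvdn2 oddM; lia.
have cop : coprimez m p by rewrite /coprimez /gcdz /= eqz_nat -/(coprime m p) coprime_sym prime_coprime.
exists (zchinese m p w1 w2); rewrite nE PoszM Gauss_dvdz //.
have key (d : int) (x y : int) : (d %| y - x)%Z -> (d %| x ^+ 2 - a)%Z -> (d %| y ^+ 2 - a)%Z.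
  move=> h k; have -> : y ^+ 2 - a = (y - x) * (y + x) + (x ^+ 2 - a) by ring.
  by rewrite dvdz_addr // dvdz_mulr.
apply/andP; split; [apply: key h1|apply: key h2]; rewrite -eqz_mod_dvd; apply/eqP.
  exact: zchinese_modl.
exact: zchinese_modr.
Qed.

Lemma hilbertMr p a b c : prime p -> odd p -> b != 0 -> c != 0 ->
  hilbert p a (b * c) = hilbert p a b (+) hilbert p a c.
Proof. by move=> *; rewrite hilbertC hilbertMl // !(hilbertC _ a). Qed.

Definition represented (a b : int) := exists x y z : int,
  ((x != 0) || (y != 0) || (z != 0)) /\ a * x ^+ 2 + b * y ^+ 2 = z ^+ 2.

Lemma representedC a b : represented a b -> represented b a.
Proof.
move=> [x [y [z [h e]]]]; exists y, x, z; split; first by move: h; case: eqP; case: eqP.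
by rewrite addrC.
Qed.

(* Legendre's theorem: the place 2 carries no condition. *)
Theorem legendre (a b : int) : a != 0 -> b != 0 ->
  (forall p, prime p -> odd p -> hilbert p a b = false) -> hilbert_oo a b = false ->
  represented a b.
Proof.
have [n] := ubnP (`|a| + `|b|); elim: n a b => // n IH a b lt_n a0 b0 loc oo.
(* A square factor changes no symbol and can be absorbed into the variables, so the descent may
   assume a and b squarefree. *)
have step (c d : int) : (`|c| + `|d| < n.+1)%N -> c != 0 -> d != 0 ->
    (forall p, prime p -> odd p -> hilbert p c d = false) -> hilbert_oo c d = false ->
    (exists2 p : nat, prime p & exists y : int, d = p%:Z * p%:Z * y) -> represented c d.
  move=> le c0 d0 locd ood [p pr_p [d' dE]].
  have p0 : p%:Z != 0 by rewrite -lt0n prime_gt0.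
  have d'0 : d' != 0 by apply: contraNneq d0 => d'0; rewrite dE d'0 mulr0.
  have [|||||x [y [z [h e]]]] := IH c d' => //.
  - have : (`|d'| < `|d|)%N; last by lia.
    rewrite dE !abszM absz_nat ltn_Pmull ?absz_gt0 //; have := prime_gt1 pr_p; nia.
  - move=> q pr_q odd_q; rewrite -(locd q pr_q odd_q) dE !hilbertMr ?mulf_neq0 //.
    by rewrite addbb.
  - by rewrite -ood dE /hilbert_oo !ltz0M ?mulf_neq0 // addbb.
  exists (p%:Z * x), y, (p%:Z * z); split; first by rewrite !mulf_eq0 (negbTE p0).
  by rewrite !exprMn -e dE; ring.
wlog le_ab : a b lt_n a0 b0 loc oo / (`|a| <= `|b|)%N.
  move=> W; have [|/ltnW le] := leqP `|a| `|b|; first exact: W.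
  apply: representedC; apply: W => //; first by rewrite addnC.
    by move=> p pr_p odd_p; rewrite hilbertC loc.
  by rewrite hilbert_ooC.
have [sqa|pa] := sqfree_or a; last first.
  apply: representedC; apply: step => //; first by rewrite addnC.
    by move=> p pr_p odd_p; rewrite hilbertC loc.
  by rewrite hilbert_ooC.
have [sqb|pb] := sqfree_or b; last exact: step.
have [b1|b2] := leqP `|b| 1.
  have ha : a = 1 \/ a = -1 by lia.
  have hb : b = 1 \/ b = -1 by lia.
  case: ha => ea; first by exists 1, 0, 1; split => //; rewrite ea; ring.
  case: hb => eb; first by exists 0, 1, 1; split => //; rewrite eb; ring.
  by move: oo; rewrite ea eb.
(* At an odd p dividing b but not a, b has valuation 1, so the symbol at p is the residue symbol of
   a. *)
have [w0 hw0] : exists w : int, (`|b|%N%:Z %| w ^+ 2 - a)%Z.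
  apply: sqrt_mod_sqfree; rewrite ?absz_gt0 // => p pr_p odd_p pb.
  have [pa|pa] := boolP (p %| `|a|)%N; first by exists 0; rewrite expr2 mulr0 sub0r abszN.
  apply: nonres_sqr => //; have := loc p pr_p odd_p.
  rewrite /hilbert (val_odd_ndvd pa) (res_bit_unit _ pa) //=.
  suff -> : val_odd p b by [].
  rewrite /val_odd; have : logn p `|b| = 1%N; last by move=> ->.
  apply/eqP; rewrite eqn_leq; apply/andP; split; last by rewrite logn_gt0 mem_primes pr_p absz_gt0 b0.
  by rewrite leqNgt -pfactor_dvdn ?absz_gt0 ?sqb.
(* With |w| <= |b|/2 and |a| <= |b|, writing w^2 - a = c b gives |c| <= |b|/4 + 1 < |b|: the descent
   from (a, b) to (a, c). *)
have [w hw wb] : exists2 w : int, (b %| w ^+ 2 - a)%Z & (`|w| * 2 <= `|b|)%N.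
  pose r := (w0 %% b)%Z; have r0 : 0 <= r by apply: modz_ge0.
  have rb : r < `|b| by apply: ltz_mod.
  have key (x : int) : (b %| x - w0)%Z -> (b %| x ^+ 2 - a)%Z.
    move=> h; have -> : x ^+ 2 - a = (x - w0) * (x + w0) + (w0 ^+ 2 - a) by ring.
    by rewrite dvdz_addr; [rewrite dvdzE; move: hw0; rewrite dvdzE absz_nat | rewrite dvdz_mulr].
  have kr : (b %| r - w0)%Z by rewrite -eqz_mod_dvd modz_mod.
  have [le|lt] := leqP (`|r| * 2) `|b|; first by exists r => //; apply: key.
  exists (r - `|b|); last by lia.
  by apply: key; rewrite addrAC dvdz_addr // dvdzN dvdzE -abszE absz_nat.
case/dvdzP: hw => c wE; have [c0|c0] := eqVneq c 0.
  exists 1, 0, w; split => //; move: wE; rewrite c0 mul0r => /eqP; rewrite subr_eq0 => /eqP ->; ring.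
have n0 : w ^+ 2 - a != 0 by rewrite wE mulf_neq0.
have lt_cb : (`|c| < `|b|)%N.
  have h1 : (`|c| * `|b| = `|w ^+ 2 - a|)%N by rewrite wE abszM.
  have h2 : (`|w ^+ 2 - a| <= `|w| ^ 2 + `|a|)%N by rewrite -abszX; lia.
  nia.
have [|||||x [y [z [h e]]]] := IH a c => //.
- by lia.
(* c b is a norm from Q(sqrt a), so (a, c b) is trivial and c inherits the conditions on b. *)
- move=> p pr_p odd_p; have := hilbert_norm pr_p odd_p sqa a0 n0.
  by rewrite wE hilbertMr // loc // addbF.
- move: oo; rewrite /hilbert_oo; case: (ltrP a 0) => //= alt bge.
  have b0' : 0 < b by lia.
  have : 0 < c * b by rewrite -wE subr_gt0 (lt_le_trans alt) // sqr_ge0.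
  by rewrite pmulr_lgt0 // => /ltW; rewrite leNgt => /negbTE.
have [y0|y0] := eqVneq y 0.
  exists x, 0, z; split; first by move: h; rewrite y0 eqxx orbF.
  by rewrite -e y0; ring.
(* Composition of norms: (w^2 - a)(z^2 - a x^2) = (w z + a x)^2 - a (w x + z)^2, and the left side
   is c b times c y^2, that is b (c y)^2. *)
exists (w * x + z), (c * y), (w * z + a * x); split; first by rewrite mulf_neq0 ?orbT.
have ez : z ^+ 2 = a * x ^+ 2 + c * y ^+ 2 by [].
have -> : b * (c * y) ^+ 2 = (c * b) * (c * y ^+ 2) by ring.
rewrite -wE; have -> : c * y ^+ 2 = z ^+ 2 - a * x ^+ 2 by rewrite ez; ring.
ring.
Qed.

(** * Nonvanishing at 1 of real Dirichlet L-series *)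

Lemma sum_multiples (V : nmodType) (d x : nat) (G : nat -> V) : (0 < d)%N ->
  \sum_(1 <= n < x.+1 | (d %| n)%N) G n = \sum_(1 <= m < (x %/ d).+1) G (d * m)%N.
Proof.
move=> d0; elim: x => [|x IH]; first by rewrite div0n !big_geq.
rewrite big_mkcond big_nat_recr //= -big_mkcond IH divnS //.
case: ifP => [h|_]; last by rewrite addr0.
rewrite add1n [RHS]big_nat_recr //=; congr (_ + G _).
by have := divnS x d0; rewrite h add1n => <-; rewrite mulnC divnK.
Qed.

Section AbelSummation.
Variable R : realFieldType.

(** Summation by parts: each step adds S(m + 1) (g m - g (m + 1)), and bounding the partial sums S
    by C makes the weights telescope. *)
Lemma abel_bound (chi g : nat -> R) (C : R) (a b : nat) :
  (forall c, (a <= c)%N -> `|\sum_(a <= n < c) chi n| <= C) ->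
  (forall n, (a <= n)%N -> 0 <= g n) -> (forall n, (a <= n)%N -> g n.+1 <= g n) ->
  `|\sum_(a <= n < b) chi n * g n| <= C * g a.
Proof.
move=> hC g0 gd; pose S c := \sum_(a <= n < c) chi n.
have C0 : 0 <= C by apply: le_trans (hC a (leqnn a)); rewrite normr_ge0.
have [ba|ab] := leqP b a; first by rewrite big_geq // normr0 mulr_ge0 ?g0.
have key k : `|\sum_(a <= n < a + k) chi n * g n - S (a + k)%N * g (a + k)%N| <= C * (g a - g (a + k)%N).
  elim: k => [|k IH]; first by rewrite addn0 /S !big_geq // mul0r subrr normr0 subrr mulr0.
  rewrite addnS; set m := (a + k)%N in IH *; have am : (a <= m)%N by rewrite leq_addr.
  have SE : S m.+1 = S m + chi m by rewrite /S big_nat_recr.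
  rewrite big_nat_recr //=; set X := \sum_(a <= n < m) _ in IH *.
  have -> : X + chi m * g m - S m.+1 * g m.+1 = (X - S m * g m) + S m.+1 * (g m - g m.+1).
    by rewrite SE; ring.
  apply: le_trans (ler_normD _ _) _.
  have h : `|S m.+1 * (g m - g m.+1)| <= C * (g m - g m.+1).
    by rewrite normrM [X in _ * X]ger0_norm ?subr_ge0 ?gd // ler_wpM2r ?subr_ge0 ?gd // hC // ltnW.
  lra.
have := key (b - a)%N; rewrite (subnKC (ltnW ab)) => h.
have h2 : `|S b * g b| <= C * g b by rewrite normrM [X in _ * X]ger0_norm ?(g0 _ (ltnW ab)) // ler_wpM2r ?(g0 _ (ltnW ab)) // hC // ltnW.
have := ler_normD (\sum_(a <= n < b) chi n * g n - S b * g b) (S b * g b).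
rewrite subrK; lra.
Qed.

End AbelSummation.

Lemma bernoulli (R : realFieldType) (x : R) (n : nat) : -1 <= x -> 1 + n%:R * x <= (1 + x) ^+ n.
Proof.
move=> x1; elim: n => [|n IH]; first by rewrite mul0r addr0.
rewrite exprS; have h : (1 + x) * (1 + n%:R * x) <= (1 + x) * (1 + x) ^+ n.
  by rewrite ler_wpM2l //; lra.
have n0 : 0 <= n%:R * (x * x) by rewrite mulr_ge0 // -expr2 sqr_ge0.
apply: le_trans h; rewrite -natr1; lra.
Qed.

Section Character.
Variable R : archiRealFieldType.
Variables (chi : nat -> R) (N : nat).
Hypotheses (N0 : (0 < N)%N) (chi_per : forall n, chi (n + N)%N = chi n)
  (chi_sum : \sum_(i < N) chi i = 0) (chi_le1 : forall n, `|chi n| <= 1).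

Lemma sum_period a : \sum_(a <= n < a + N) chi n = 0.
Proof.
elim: a => [|a IH]; first by rewrite add0n big_mkord.
have aN : (a < a + N)%N by lia.
by rewrite addSn big_nat_recr //= chi_per addrC -big_ltn.
Qed.

Lemma chi_sum_bound a b : `|\sum_(a <= n < b) chi n| <= N%:R.
Proof.
have [k] := ubnP (b - a); elim: k a => // k IH a lt.
have [ba|ab] := leqP b a; first by rewrite big_geq // normr0.
have [le|lt'] := leqP (a + N) b.
  rewrite (big_cat_nat _ le) ?leq_addr //= sum_period add0r.
  by apply: IH; lia.
apply: le_trans (ler_norm_sum _ _ _) _.
apply: (@le_trans _ _ (\sum_(a <= n < b) 1)); first by apply: ler_sum => n _.
by rewrite sumr_const_nat ler_nat; lia.
Qed.

Definition Lsum (x : nat) : R := \sum_(1 <= n < x.+1) chi n / n%:R.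

(** Abel summation against 1/n. The explicit rate is used in Shapiro's argument with x %/ d in place
    of x. *)
Lemma Lsum_diff x y : (x <= y)%N -> `|Lsum y - Lsum x| <= N%:R / x.+1%:R.
Proof.
move=> xy; rewrite /Lsum (@big_cat_nat _ _ _ x.+1 1 y.+1) //= addrAC subrr add0r.
apply: (@abel_bound _ chi (fun n => n%:R^-1) N%:R x.+1) => [c _|n _|n xn].
- exact: chi_sum_bound.
- by rewrite invr_ge0.
- by rewrite lef_pV2 ?ler_nat ?posrE ?ltr0n // (leq_trans _ xn).
Qed.

Hypotheses (chiM : forall m n, chi (m * n)%N = chi m * chi n)
  (chi1 : chi 1%N = 1) (chi_val : forall n, [\/ chi n = 0, chi n = 1 | chi n = -1]).

Definition div_sum (n : nat) : R := \sum_(1 <= d < n.+1 | (d %| n)%N) chi d.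

Lemma div_sum_widen n x : (0 < n <= x)%N -> \sum_(1 <= d < x.+1 | (d %| n)%N) chi d = div_sum n.
Proof.
move=> /andP[n0 nx]; rewrite (@big_cat_nat _ _ _ n.+1 1 x.+1) //= [X in _ + X]big_nat_cond.
rewrite [X in _ + X]big1 ?addr0 // => i /andP[/andP[ni _] /dvdn_leq]; move/(_ n0); lia.
Qed.

(** Divisors of p n divisible by p are p times a divisor of n; the others are the divisors of the
    p'-part of n. *)
Lemma div_sum_prime p n : prime p -> (0 < n)%N ->
  div_sum (p * n) = chi p * div_sum n + div_sum (n`_p^')%N.
Proof.
move=> pr_p n0; have p0 := prime_gt0 pr_p; rewrite {1}/div_sum (bigID (fun d => p %| d)%N) /=; congr (_ + _).
  rewrite big_mkcondl /= sum_multiples // mulKn // /div_sum big_distrr [RHS]big_mkcond /=.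
  by apply: eq_bigr => d _; rewrite dvdn_pmul2l // chiM; case: ifP.
have m0 : (0 < n`_p^')%N by rewrite part_gt0.
rewrite -(@div_sum_widen _ (p * n)); last first.
  by rewrite m0 (leq_trans (dvdn_leq n0 (dvdn_part _ _))) // leq_pmull.
apply: eq_bigl => d; apply/andP/idP => [[dv pd]|dv].
  have d0 : (0 < d)%N by apply: dvdn_gt0 dv; rewrite muln_gt0 p0.
  have dp' : p^'.-nat d by rewrite p'natE.
  have dn : (d %| n)%N by rewrite -(@Gauss_dvdr _ p) // coprime_sym prime_coprime.
  by rewrite -(part_pnat_id dp') partn_dvd.
split; first exact: dvdn_trans dv (dvdn_mull _ (dvdn_part _ _)).
rewrite -p'natE ?(dvdn_gt0 _ dv) //; exact: pnat_dvd dv (part_pnat _ _).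
Qed.

Lemma div_sum_pfactor p k m : prime p -> (0 < m)%N -> ~~ (p %| m)%N ->
  div_sum (p ^ k * m) = (\sum_(j < k.+1) chi p ^+ j) * div_sum m.
Proof.
move=> pr_p m0 pm; elim: k => [|k IH]; first by rewrite mul1n big_ord1 mul1r.
have pk0 : (0 < p ^ k)%N by rewrite expn_gt0 prime_gt0.
have n0 : (0 < p ^ k * m)%N by rewrite muln_gt0 pk0.
rewrite expnS -mulnA div_sum_prime // IH.
have -> : ((p ^ k * m)`_p^' = m)%N.
  rewrite partnM // part_p'nat ?mul1n ?part_pnat_id ?p'natE //.
  by rewrite pnatNK pnatX pnat_id.
rewrite [in RHS]big_ord_recl expr0 mulrDl mul1r addrC; congr (_ + _).
by rewrite mulrA; congr (_ * _); rewrite big_distrr /=; apply: eq_bigr => i _; rewrite exprS.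
Qed.

(** The local factor of [div_sum] at a prime of exponent k. Even exponents give at least 1, which is
    why squares are singled out next. *)
Lemma geom_val (c : R) k : [\/ c = 0, c = 1 | c = -1] ->
  0 <= \sum_(j < k.+1) c ^+ j /\ (~~ odd k -> 1 <= \sum_(j < k.+1) c ^+ j).
Proof.
case=> ->.
- by rewrite big_ord_recl big1 ?addr0 // => i _; rewrite exprS mul0r.
- rewrite (eq_bigr (fun=> 1)) => [|i _]; last by rewrite expr1n.
  by rewrite sumr_const card_ord; split => // _; rewrite ler1n.
- have -> : \sum_(j < k.+1) (-1) ^+ j = (~~ odd k)%:R :> R.
    elim: k => [|k IH]; first by rewrite big_ord1.
    rewrite big_ord_recr /= IH -signr_odd /=; case: (odd k) => /=; ring.
  by case: (odd k).
Qed.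

Lemma div_sum_bound n : (0 < n)%N ->
  0 <= div_sum n /\ (forall j, n = (j ^ 2)%N -> 1 <= div_sum n).
Proof.
elim/ltn_ind: n => n IH n0; have [n1|n1] := leqP n 1.
  have -> : n = 1%N by lia.
  by rewrite /div_sum big_mkcond big_nat1 /= chi1; split.
have pr := pdiv_prime n1; set p := pdiv n in pr.
have [m pm nE] := pfactor_coprime pr n0.
have pm' : ~~ (p %| m)%N by rewrite -prime_coprime.
have m0 : (0 < m)%N by move: n0; rewrite nE muln_gt0 => /andP[].
have mn : (m < n)%N.
  rewrite nE -[X in (X < _)%N]muln1 ltn_pmul2l // -(expn0 p) ltn_exp2l ?prime_gt1 //.
  by rewrite logn_gt0 mem_primes pr n0 pdiv_dvd.
have [IH0 IH1] := IH m mn m0.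
have [g0 g1] := geom_val (logn p n) (chi_val p).
have dE : div_sum n = (\sum_(j < (logn p n).+1) chi p ^+ j) * div_sum m.
  by rewrite {1}nE mulnC div_sum_pfactor.
split => [|j nj]; first by rewrite dE mulr_ge0.
have j0 : (0 < j)%N by move: n0; rewrite nj; case: (j).
have mE : m = (j`_p^' ^ 2)%N.
  have := partnC p n0; rewrite p_part => h.
  have := partnX p^' j 2; rewrite -nj => <-; apply/eqP.
  rewrite -(@eqn_pmul2l (p ^ logn p n)) ?expn_gt0 ?prime_gt0 // h; apply/eqP.
  by rewrite mulnC -nE.
have lE : ~~ odd (logn p n) by rewrite nj lognX mul2n odd_double.
have := g1 lE; have := IH1 _ mE; rewrite dE; nra.
Qed.

(* Monsky's argument: if the L-series were small at 1, the Lambert series with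
   coefficients [chi n] would stay bounded as [t -> 1], whereas its power series
   has coefficients [div_sum n >= 0], at least 1 at the squares.  Taking
   [t = u ^+ 2] lets AM-GM be stated without square roots. *)
Section Lambert.
Variable u : R.
Hypotheses (u0 : 0 < u) (u1 : u < 1).
Let t := u ^+ 2.
Let t0 : 0 < t. Proof. by rewrite exprn_gt0. Qed.
Let t1 : t < 1. Proof. by rewrite exprn_ilt1 // ltW. Qed.
Let geo n := \sum_(i < n) t ^+ i.

Let geoE n : (1 - t) * geo n = 1 - t ^+ n.
Proof. by rewrite -[1 in RHS](expr1n _ n) subrXX; congr (_ * _); apply: eq_bigr => i _; rewrite expr1n mul1r. Qed.

Let geo_gt0 n : 0 < geo n.+1.
Proof.
rewrite /geo big_ord_recl expr0 ltr_pwDl // sumr_ge0 // => i _.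
by rewrite exprn_ge0 // ltW.
Qed.

(** AM-GM for 1, t, ..., t^n, whose geometric mean is u^n. The induction goes by twos: the outer
    pair satisfies 1 + t^(n+2) >= 2 u^(n+2), and the inner terms are t times the case n. *)
Let geo_amgm n : n.+1%:R * u ^+ n <= geo n.+1.
Proof.
elim/ltn_ind: n => -[|[|n]] IH.
- by rewrite /geo big_ord1 !expr0 mulr1.
- rewrite /geo !big_ord_recl big_ord0 /t; have := sqr_ge0 (1 - u); rewrite /=; lra.
have := IH n (ltnW (ltnSn _)); set a := _ * u ^+ n => h.
have -> : geo n.+3 = 1 + t * geo n.+1 + t ^+ n.+2.
  rewrite /geo big_ord_recr big_ord_recl /= expr0; congr (_ + _ + _).
  by rewrite big_distrr /=; apply: eq_bigr => i _; rewrite exprS.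
have -> : n.+3%:R * u ^+ n.+2 = 2 * u ^+ n.+2 + t * a.
  by rewrite /a /t -addn2 natrD -(addn2 n) exprD; ring.
have := sqr_ge0 (1 - u ^+ n.+2); have : t ^+ n.+2 = (u ^+ n.+2) ^+ 2 by rewrite /t -!exprM mulnC.
have : t * a <= t * geo n.+1 by rewrite ler_wpM2l // ltW.
lra.
Qed.

(** The 1/n weight scaled by 1/(1 - t), minus the Lambert weight. It is nonnegative, decreasing and
    equal to 1 at n = 1, so Abel summation bounds its sum against [chi] by N, uniformly in t. *)
Let lambert n : R := (n%:R * (1 - t))^-1 - t ^+ n / (1 - t ^+ n).

Let tn_lt1 n : t ^+ n.+1 < 1.
Proof. by rewrite exprn_ilt1 // ltW. Qed.

Let lambertE n : lambert n.+1 = (n.+1%:R^-1 - t ^+ n.+1 / geo n.+1) / (1 - t).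
Proof.
have := geoE n.+1; have := geo_gt0 n; move: (geo _) => g g0 gE.
rewrite /lambert -gE; field.
by rewrite gt_eqF ?subr_gt0 // (gt_eqF g0) //= addrC natr1 pnatr_eq0.
Qed.

Let lambert_ge0 n : 0 <= lambert n.+1.
Proof.
rewrite lambertE divr_ge0 ?subr_ge0 ?(ltW t1) //.
rewrite ler_pdivrMr // ler_pdivlMl //; apply: le_trans (geo_amgm n).
by rewrite ler_pM2l ?ltr0n // /t -exprM ler_wiXn2l ?(ltW u0) ?(ltW u1) //; lia.
Qed.

Let lambert_dec n : lambert n.+2 <= lambert n.+1.
Proof.
rewrite !lambertE ler_pM2r ?invr_gt0 ?subr_gt0 //.
have := geo_amgm n; have := geo_amgm n.+1.
have : geo n.+2 = 1 + t * geo n.+1.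
  rewrite {1}/geo big_ord_recl expr0; congr (_ + _).
  by rewrite big_distrr /=; apply: eq_bigr => i _; rewrite exprS.
have := geo_gt0 n; have := geo_gt0 n.+1.
move: (geo n.+1) (geo n.+2) => g h h0 g0 hE hh hg.
have x0 : 0 < n.+1%:R :> R by rewrite ltr0n.
have xE : n.+2%:R = n.+1%:R + 1 :> R by rewrite natr1.
have uE : t ^+ n.+1 <= u ^+ n * u ^+ n.+1.
  by rewrite -exprD /t -exprM ler_wiXn2l ?(ltW u0) ?(ltW u1) //; lia.
(* AM-GM at n and at n + 1, with u^(2n+1) >= t^(n+1). The decrease of the weights amounts to this
   inequality after clearing denominators. *)
have key : n.+1%:R * n.+2%:R * t ^+ n.+1 <= g * h.
  apply: (@le_trans _ _ ((n.+1%:R * u ^+ n) * (n.+2%:R * u ^+ n.+1))).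
    by rewrite mulrACA ler_pM2l // mulr_gt0 // ltr0n.
  by apply: ler_pM => //; rewrite mulr_ge0 ?exprn_ge0 // ltW.
rewrite exprS -subr_ge0; move: key; set a := t ^+ n.+1; rewrite xE; move: (n.+1%:R) x0 => x x0 key.
have -> : x^-1 - a / g - ((x + 1)^-1 - t * a / h) = (g * h - x * (x + 1) * a) / (x * (x + 1) * g * h).
  by rewrite hE; field; rewrite -hE !gt_eqF // ltr_wpDr.
by rewrite divr_ge0 ?subr_ge0 // !mulr_ge0 ?ltW // ltr_wpDr.
Qed.

Let lambert1 : lambert 1 = 1.
Proof.
by rewrite /lambert expr1 mul1r; field; rewrite gt_eqF ?subr_gt0.
Qed.

Let tX_ge0 n : 0 <= t ^+ n. Proof. exact: exprn_ge0 (ltW t0). Qed.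

Let lambert_tail d q : (0 < d)%N ->
  t ^+ d / (1 - t ^+ d) - \sum_(1 <= j < q.+1) t ^+ (d * j) = t ^+ (d * q.+1) / (1 - t ^+ d).
Proof.
case: d => // d _; have nz : 1 - t ^+ d.+1 != 0 by rewrite gt_eqF // subr_gt0.
elim: q => [|q IH]; first by rewrite big_geq // subr0 muln1.
rewrite big_nat_recr //= opprD addrA IH [(d.+1 * q.+2)%N]mulnS exprD.
by field.
Qed.

Let lambert_sum_bound K : `|\sum_(1 <= n < K.+1) chi n * lambert n| <= N%:R.
Proof.
have := @abel_bound _ chi lambert N%:R 1 K.+1; rewrite lambert1 mulr1; apply.
- by move=> c _; apply: chi_sum_bound.
- by case.
- by case.
Qed.

Let sum_div_sum K : \sum_(1 <= m < K.+1) div_sum m * t ^+ m =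
  \sum_(1 <= d < K.+1) chi d * \sum_(1 <= j < (K %/ d).+1) t ^+ (d * j).
Proof.
transitivity (\sum_(1 <= m < K.+1) \sum_(1 <= d < K.+1) (if (d %| m)%N then chi d * t ^+ m else 0)).
  apply: eq_big_nat => m /andP[m0 mK]; rewrite -(@div_sum_widen m K) ?m0 //.
  by rewrite big_distrl [LHS]big_mkcond.
rewrite exchange_big_nat /=; apply: eq_big_nat => d /andP[d0 _].
by rewrite -big_mkcond /= -big_distrr sum_multiples.
Qed.

(** Only the squares are kept: J terms, each at least t^(J^2). *)
Let div_sum_squares J : J%:R * t ^+ (J ^ 2) <= \sum_(1 <= m < (J ^ 2).+1) div_sum m * t ^+ m.
Proof.
apply: (@le_trans _ _ (\sum_(1 <= j < J.+1) t ^+ (j ^ 2))).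
  rewrite big_add1 /= big_mkord -[J in J%:R]card_ord -sumr_const mulr_suml.
  apply: ler_sum => i _; rewrite mul1r ler_wiXn2l ?(ltW t0) ?(ltW t1) //.
  by rewrite leq_sqr ltn_ord.
elim: J => [|J IH]; first by rewrite !big_geq.
have JJ : (J ^ 2 < J.+1 ^ 2)%N by rewrite ltn_sqr.
rewrite big_nat_recr //= (@big_cat_nat _ _ _ (J ^ 2).+1 1 (J.+1 ^ 2).+1) //=; last exact: ltnW.
rewrite lerD // big_nat_recr //=.
have h n : (0 < n)%N -> 0 <= div_sum n * t ^+ n.
  by move=> n0; rewrite mulr_ge0 ?tX_ge0 //; case: (div_sum_bound n0).
have [_ /(_ J.+1 erefl) h1] := @div_sum_bound (J.+1 ^ 2) isT.
apply: ler_wpDl; last by rewrite ler_peMl // tX_ge0.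
by rewrite big_nat_cond sumr_ge0 // => i /andP[/andP[Ji _] _]; apply: h; lia.
Qed.

Lemma lambert_ineq J K : (J ^ 2 <= K)%N ->
  J%:R * t ^+ (J ^ 2) <= `|Lsum K| / (1 - t) + N%:R + K%:R * t ^+ K / (1 - t).
Proof.
move=> JK; apply: le_trans (div_sum_squares J) _.
apply: (@le_trans _ _ (\sum_(1 <= m < K.+1) div_sum m * t ^+ m)).
  rewrite (@big_cat_nat _ _ _ (J ^ 2).+1 1 K.+1) //= ler_wpDr //.
  rewrite big_nat_cond sumr_ge0 // => n /andP[/andP[Jn _] _].
  rewrite mulr_ge0 ?tX_ge0 //; case: (@div_sum_bound n) => //; lia.
rewrite sum_div_sum.
pose S2 := \sum_(1 <= n < K.+1) chi n * (t ^+ n / (1 - t ^+ n)).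
have e1 : \sum_(1 <= n < K.+1) chi n * lambert n = Lsum K / (1 - t) - S2.
  rewrite /Lsum mulr_suml -sumrB; apply: eq_big_nat => n /andP[n0 _].
  by rewrite /lambert mulrBr; congr (_ - _); rewrite invfM mulrA.
have h1 := lambert_sum_bound K; rewrite e1 in h1.
have t1' : 0 < 1 - t by rewrite subr_gt0.
have h2 : Lsum K / (1 - t) <= `|Lsum K| / (1 - t) by rewrite ler_pM2r ?invr_gt0 // ler_norm.
have h3 : S2 <= `|Lsum K| / (1 - t) + N%:R.
  have := ler_norm (- (Lsum K / (1 - t) - S2)); rewrite normrN; lra.
(* Truncation error: the geometric tail for d starts at exponent d (K %/ d + 1) >= K, so each of the
   K tails is at most t^K / (1 - t). *)
suff : `|\sum_(1 <= d < K.+1) chi d * (\sum_(1 <= j < (K %/ d).+1) t ^+ (d * j)) - S2|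
    <= K%:R * t ^+ K / (1 - t).
  by set X := \sum_(_ <= _ < _) _; have := ler_norm (X - S2); lra.
rewrite distrC /S2 -sumrB; apply: le_trans (ler_norm_sum _ _ _) _.
have -> : K%:R * t ^+ K / (1 - t) = \sum_(1 <= d < K.+1) t ^+ K / (1 - t).
  by rewrite sumr_const_nat subn1 -[RHS]mulr_natl mulrA.
apply: ler_sum_nat => d /andP[d0 dK]; rewrite -mulrBr lambert_tail // normrM.
case: d d0 dK => // d _ dK; have td : 0 < 1 - t ^+ d.+1 by rewrite subr_gt0.
have h4 : 0 <= t ^+ (d.+1 * (K %/ d.+1).+1) / (1 - t ^+ d.+1).
  by rewrite divr_ge0 ?tX_ge0 ?(ltW td).
rewrite (ger0_norm h4); apply: (@le_trans _ _ (1 * (t ^+ (d.+1 * (K %/ d.+1).+1) / (1 - t ^+ d.+1)))).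
  by rewrite ler_wpM2r.
rewrite mul1r; apply: ler_pM; rewrite ?tX_ge0 ?invr_ge0 ?(ltW td) //.
  rewrite ler_wiXn2l ?(ltW t0) ?(ltW t1) // ltnW //.
  by rewrite mulnC ltn_ceil.
rewrite lef_pV2 ?posrE // lerD2l lerN2 -[leRHS]expr1 ler_wiXn2l ?(ltW t0) ?(ltW t1) //.
Qed.

End Lambert.

(** With 1/u = 1 + h, Bernoulli gives u^K <= 1/(K h); squaring leaves a factor 1/K to spare. *)
Lemma expr_mul_small (u c : R) : 0 < u -> u < 1 -> 0 < c ->
  exists K0, forall K, (K0 <= K)%N -> K%:R * (u ^+ 2) ^+ K <= c.
Proof.
move=> u0 u1 c0; pose h := u^-1 - 1.
have h0 : 0 < h by rewrite subr_gt0 invf_gt1.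
exists (Num.bound (h ^- 2 / c)).+1 => K hK.
have K0 : 0 < K%:R :> R by rewrite ltr0n (leq_trans _ hK).
have hb : h ^- 2 / c < K%:R.
  apply: lt_le_trans (archi_boundP _) _; last by rewrite ler_nat ltnW.
  by rewrite divr_ge0 ?(ltW c0) // invr_ge0 exprn_ge0 // ltW.
have b1 : K%:R * h <= u^-1 ^+ K.
  have := @bernoulli _ h K; rewrite (_ : 1 + h = u^-1); last by rewrite /h; ring.
  by move=> /(_ _)/le_trans; move=> H; apply: le_trans (H _ _ (lexx _)); lra.
have b2 : u ^+ K <= (K%:R * h)^-1.
  by rewrite -[leLHS]invrK lef_pV2 ?posrE ?invr_gt0 ?exprn_gt0 ?mulr_gt0 // -exprVn.
have b3 : (u ^+ 2) ^+ K <= (K%:R * h) ^- 2.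
  rewrite -exprM mulnC exprM -exprVn; apply: lerXn2r => //; rewrite nnegrE ?exprn_ge0 ?(ltW u0) //.
  by rewrite invr_ge0 mulr_ge0 // ltW.
apply: (@le_trans _ _ (K%:R * (K%:R * h) ^- 2)); first by rewrite ler_pM2l.
have -> : K%:R * (K%:R * h) ^- 2 = h ^- 2 / K%:R by field; rewrite !gt_eqF.
by rewrite ler_pdivrMr // mulrC -ler_pdivrMr // ltW.
Qed.

Theorem Lsum_nonvanishing : exists2 c : R, 0 < c & exists K0, forall K, (K0 <= K)%N -> c <= `|Lsum K|.
Proof.
(* By Bernoulli, u makes t^(J^2) at least 1/2, so the left side of [lambert_ineq] is at least J/2 =
   N + 2. The Abel term takes N and the truncation term at most 1, which leaves |Lsum K| / (1 - t)
   >= 1. *)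
pose J := (2 * (N + 2))%N; pose u : R := 1 - (4 * J%:R ^+ 2)^-1.
have J1 : 1 <= J%:R :> R by rewrite ler1n /J; lia.
have J2 : 1 <= J%:R ^+ 2 :> R by rewrite exprn_ege1.
have v0 : 0 < (4 * J%:R ^+ 2)^-1 :> R by rewrite invr_gt0; lra.
have v1 : (4 * J%:R ^+ 2)^-1 < 1 :> R by rewrite invf_lt1; lra.
have u0 : 0 < u by rewrite /u; lra.
have u1 : u < 1 by rewrite /u; lra.
have t1 : 0 < 1 - u ^+ 2 by rewrite subr_gt0 exprn_ilt1 // ltW.
have [K0 hK0] := expr_mul_small u0 u1 t1.
exists (1 - u ^+ 2) => //; exists (maxn K0 (J ^ 2)) => K; rewrite geq_max => /andP[K0K JK].
have := lambert_ineq u0 u1 JK; have := hK0 K K0K.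
have hb : 2^-1 <= (u ^+ 2) ^+ (J ^ 2).
  rewrite -exprM; apply: le_trans (bernoulli _ _); last by lra.
  rewrite natrM natrX; set x := J%:R ^+ 2 in J2 *.
  have -> : 1 + 2%:R * x * - (4 * x)^-1 = 2^-1 by field; rewrite gt_eqF //; lra.
  by [].
have hJ : J%:R * 2^-1 <= J%:R * (u ^+ 2) ^+ (J ^ 2) by rewrite ler_wpM2l.
have JE : J%:R * 2^-1 = N%:R + 2 :> R by rewrite /J natrM natrD; field.
move: t1; set c := 1 - u ^+ 2 => c0 h1 h2.
have h3 : K%:R * (u ^+ 2) ^+ K / c <= 1 by rewrite ler_pdivrMr // mul1r.
have : 1 <= `|Lsum K| / c by lra.
by rewrite ler_pdivlMr // mul1r.
Qed.

End Character.

(** * Sums over prime powers *)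

Section VonMangoldt.
(* [ell] stands for the natural logarithm. *)
Variables (R : archiRealFieldType) (ell : nat -> R).
Hypotheses (ellM : forall m n, (0 < m)%N -> (0 < n)%N -> ell (m * n)%N = ell m + ell n)
  (ell_homo : forall m n, (0 < m <= n)%N -> ell m <= ell n)
  (ell_step : forall n, (0 < n)%N -> n%:R * (ell n.+1 - ell n) <= 1).

Lemma ell1 : ell 1 = 0.
Proof. by have := ellM (ltn0Sn 0) (ltn0Sn 0); rewrite mul1n; lra. Qed.

Lemma ell_ge0 n : (0 < n)%N -> 0 <= ell n.
Proof. by move=> n0; rewrite -ell1 ell_homo. Qed.

(* The sum of [Lambda d * F d] over prime powers, truncated generously: every [F]
   of interest vanishes beyond [x]. *)
Definition mangoldt_sum (x : nat) (F : nat -> R) : R :=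
  \sum_(1 <= p < x.+1 | prime p) \sum_(1 <= k < x.+1) ell p * F (p ^ k)%N.

Lemma mangoldt_sum_le x F G : (forall d, (0 < d)%N -> F d <= G d) -> mangoldt_sum x F <= mangoldt_sum x G.
Proof.
move=> FG; rewrite /mangoldt_sum big_nat_cond [leRHS]big_nat_cond; apply: ler_sum => p /andP[/andP[p0 _] pr_p].
apply: ler_sum => k _; rewrite ler_wpM2l ?ell_ge0 // FG // expn_gt0 p0 //.
Qed.

Lemma mangoldt_sum_ext x F G : (forall d, (0 < d)%N -> F d = G d) -> mangoldt_sum x F = mangoldt_sum x G.
Proof. by move=> FG; apply/eqP; rewrite eq_le !mangoldt_sum_le // => d d0; rewrite FG. Qed.

Lemma mangoldt_sum_add x F G : mangoldt_sum x (fun d => F d + G d) = mangoldt_sum x F + mangoldt_sum x G.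
Proof.
rewrite /mangoldt_sum -big_split /=; apply: eq_bigr => p _; rewrite -big_split /=.
by apply: eq_bigr => k _; rewrite mulrDr.
Qed.

Lemma mangoldt_sum_scale x c F : mangoldt_sum x (fun d => c * F d) = c * mangoldt_sum x F.
Proof.
rewrite /mangoldt_sum big_distrr /=; apply: eq_bigr => p _; rewrite big_distrr /=.
by apply: eq_bigr => k _; rewrite mulrCA.
Qed.

Lemma mangoldt_sum_norm x F : `|mangoldt_sum x F| <= mangoldt_sum x (fun d => `|F d|).
Proof.
apply: le_trans (ler_norm_sum _ _ _) _; rewrite /mangoldt_sum big_nat_cond [leRHS]big_nat_cond.
apply: ler_sum => p /andP[/andP[p0 _] _]; apply: le_trans (ler_norm_sum _ _ _) _.
by apply: ler_sum => k _; rewrite normrM ger0_norm ?ell_ge0.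
Qed.

Lemma mangoldt_sum_widen x y F : (x <= y)%N -> (forall d, (x < d)%N -> F d = 0) -> mangoldt_sum y F = mangoldt_sum x F.
Proof.
move=> xy F0; have z p k : (1 < p)%N -> (x < p)%N || (x < k)%N -> (0 < k)%N -> F (p ^ k)%N = 0.
  move=> p1 h k0; apply: F0; case/orP: h => h; last exact: ltn_trans h (ltn_expl _ p1).
  by rewrite (leq_trans h) // -[X in (X <= _)%N]expn1 leq_exp2l.
rewrite /mangoldt_sum (@big_cat_nat _ _ _ x.+1 1 y.+1) //= [X in _ + X]big_nat_cond.
rewrite [X in _ + X]big1 ?addr0 => [|p /andP[/andP[xp _] pr_p]]; last first.
  rewrite big_nat_cond big1 // => k /andP[/andP[k0 _] _].
  by rewrite z ?mulr0 ?prime_gt1 // xp.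
apply: eq_bigr => p pr_p; rewrite (@big_cat_nat _ _ _ x.+1 1 y.+1) //= [X in _ + X]big_nat_cond.
rewrite [X in _ + X]big1 ?addr0 // => k /andP[/andP[xk _] _].
by rewrite z ?mulr0 ?prime_gt1 // ?xk ?orbT //; lia.
Qed.

Lemma ell_logn n x : (0 < n <= x)%N -> ell n = \sum_(1 <= p < x.+1 | prime p) (logn p n)%:R * ell p.
Proof.
elim/ltn_ind: n => n IH /andP[n0 nx]; have [n1|n1] := leqP n 1.
  have -> : n = 1%N by lia.
  by rewrite ell1 big1 // => p _; rewrite logn1 mul0r.
have pr := pdiv_prime n1; set q := pdiv n in pr; have qn : (q %| n)%N := pdiv_dvd n.
have q0 := prime_gt0 pr; have q1 := prime_gt1 pr.
have m0 : (0 < n %/ q)%N by rewrite divn_gt0 // dvdn_leq.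
have mn : (n %/ q < n)%N by rewrite ltn_Pdiv.
have qx : (q < x.+1)%N by rewrite ltnS (leq_trans _ nx) // dvdn_leq.
rewrite -(divnK qn) ellM // (IH _ mn) ?m0 ?(leq_trans (ltnW mn)) //.
rewrite [RHS](eq_bigr (fun p => (logn p (n %/ q))%:R * ell p + (logn p q)%:R * ell p)); last first.
  by move=> p _; rewrite lognM // natrD mulrDl.
rewrite big_split /=; congr (_ + _).
rewrite big_mkcond (@bigD1_seq _ _ _ _ _ q) ?mem_index_iota ?iota_uniq ?q0 //=.
rewrite pr logn_prime // eqxx mul1r big1 ?addr0 // => p /negbTE pq.
by case: ifP => // pr_p; rewrite logn_prime // pq mul0r.
Qed.

Lemma logn_count p n x : prime p -> (0 < n <= x)%N ->
  logn p n = (\sum_(1 <= k < x.+1) (p ^ k %| n))%N.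
Proof.
move=> pr_p /andP[n0 nx]; rewrite logn_count_dvd // (@big_cat_nat _ _ _ n 1 x.+1) //=; last lia.
rewrite [X in (_ + X)%N]big_nat_cond [X in (_ + X)%N]big1 ?addn0 // => k /andP[/andP[nk _] _].
apply/eqP; rewrite eqb0; apply/negP => /dvdn_leq => /(_ n0).
by rewrite leqNgt (leq_ltn_trans nk) // ltn_expl // prime_gt1.
Qed.

(** log n is the sum of Lambda over the divisors of n; the two summations are exchanged. *)
Lemma mangoldt_sum_conv x (g : nat -> R) :
  \sum_(1 <= n < x.+1) g n * ell n = mangoldt_sum x (fun d => \sum_(1 <= m < (x %/ d).+1) g (d * m)%N).
Proof.
transitivity (\sum_(1 <= n < x.+1) \sum_(1 <= p < x.+1 | prime p) \sum_(1 <= k < x.+1)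
    (if (p ^ k %| n)%N then ell p * g n else 0)).
  apply: eq_big_nat => n nx; rewrite (@ell_logn n x) // big_distrr /=.
  apply: eq_bigr => p pr_p; rewrite (logn_count pr_p nx) natr_sum big_distrl big_distrr /=.
  by apply: eq_bigr => k _; case: (_ %| _)%N; rewrite ?mul1r ?mul0r ?mulr0 // mulrC.
rewrite (exchange_big_nat _ _ _ _ _ xpredT) /= /mangoldt_sum; apply: eq_bigr => p pr_p.
rewrite exchange_big_nat /=; apply: eq_bigr => k _.
by rewrite -big_mkcond /= -big_distrr /= sum_multiples // expn_gt0 prime_gt0.
Qed.

Definition ell_fact x : R := \sum_(1 <= n < x.+1) ell n.

(** Legendre's formula for the factorisation of x!, [ell_fact x] being log x!. *)
Lemma ell_fact_mangoldt x : ell_fact x = mangoldt_sum x (fun d => (x %/ d)%:R).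
Proof.
rewrite /ell_fact (eq_bigr (fun n => 1 * ell n)); last by move=> n _; rewrite mul1r.
rewrite mangoldt_sum_conv; apply: mangoldt_sum_ext => d d0.
by rewrite sumr_const_nat subn1.
Qed.

Lemma ell_fact_ge x : (0 < x)%N -> x%:R * ell x - x%:R <= ell_fact x.
Proof.
elim: x => // -[|x] IH _; first by rewrite /ell_fact big_nat1 ell1; lra.
have -> : ell_fact x.+2 = ell_fact x.+1 + ell x.+2 by rewrite /ell_fact big_nat_recr.
by have := IH isT; have := ell_step (ltn0Sn x); rewrite -[x.+2%:R]natr1; lra.
Qed.

(** The lower half of Mertens' theorem: replace x %/ d by x / d in Legendre's formula and compare
    with x log x - x <= log x!. *)
Lemma mertens x : (0 < x)%N -> ell x - 1 <= mangoldt_sum x (fun d => (d <= x)%N%:R / d%:R).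
Proof.
move=> x0; have xR : 0 < x%:R :> R by rewrite ltr0n.
rewrite -(ler_pM2l xR) mulrBr mulr1; apply: le_trans (ell_fact_ge x0) _.
rewrite ell_fact_mangoldt -mangoldt_sum_scale; apply: mangoldt_sum_le => d d0; have dR : 0 < d%:R :> R by rewrite ltr0n.
rewrite mulrA ler_pdivlMr //; have [dx|xd] := leqP d x; last by rewrite divn_small // mul0r mulr0.
by rewrite mulr1 -natrM ler_nat leq_trunc_div.
Qed.

Definition psi x := mangoldt_sum x (fun d => (d <= x)%N%:R).

Lemma psi_le x y : (x <= y)%N -> psi x <= psi y.
Proof.
move=> xy; rewrite /psi -(@mangoldt_sum_widen x y) // => [|d]; last by rewrite ltnNge => /negbTE ->.
by apply: mangoldt_sum_le => d _; rewrite ler_nat; case: (leqP d x) => // dx; rewrite (leq_trans dx xy).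
Qed.

(** Chebyshev's use of the central binomial coefficient: (2n) %/ d - 2 (n %/ d) is never negative
    and equals 1 for n < d <= 2n, while log (2n)! - 2 log n! <= 2n log 2. *)
Lemma psi_double n : psi n.*2 <= psi n + n.*2%:R * ell 2.
Proof.
have nn : (n <= n.*2)%N by rewrite -addnn leq_addr.
have e1 : psi n.*2 + 2 * ell_fact n <= ell_fact n.*2 + psi n.
  rewrite /psi !ell_fact_mangoldt -(@mangoldt_sum_widen n n.*2 (fun d => (d <= n)%N%:R)) //; last first.
    by move=> d; rewrite ltnNge => /negbTE ->.
  rewrite -(@mangoldt_sum_widen n n.*2 (fun d => (n %/ d)%:R)) //; last by move=> d nd; rewrite divn_small.
  rewrite -mangoldt_sum_scale -!mangoldt_sum_add; apply: mangoldt_sum_le => d d0; rewrite -natrM -!natrD ler_nat.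
  have h : (2 * (n %/ d) <= n.*2 %/ d)%N.
    by rewrite leq_divRL // -mulnA -muln2 [(_ * 2)%N]mulnC leq_mul2l /= leq_trunc_div.
  have [dn|nd] := leqP d n; first by rewrite (leq_trans dn nn) addnC leq_add2r.
  rewrite [(n %/ d)%N]divn_small // muln0 !addn0; have [d2n|//] := leqP d n.*2.
  by rewrite divn_gt0.
have e2 m : ell_fact m.*2 <= 2 * ell_fact m + m.*2%:R * ell 2.
  elim: m => [|m IH]; first by rewrite /ell_fact !big_geq // mulr0 add0r mul0r.
  have -> : ell_fact m.+1 = ell_fact m + ell m.+1 by rewrite /ell_fact big_nat_recr.
  have -> : ell_fact m.+1.*2 = ell_fact m.*2 + ell m.*2.+1 + ell m.*2.+2.
    by rewrite doubleS /ell_fact [LHS]big_nat_recr //= [in LHS]big_nat_recr.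
  have h1 : ell m.*2.+2 = ell 2 + ell m.+1 by rewrite -ellM // mul2n doubleS.
  have h2 : ell m.*2.+1 <= ell m.*2.+2 by apply: ell_homo; rewrite /= leqnSn.
  have -> : m.+1.*2%:R = m.*2%:R + 2 :> R by rewrite doubleS -addn2 natrD.
  lra.
have := e2 n; lra.
Qed.

Lemma chebyshev n : psi n <= 4 * n%:R * ell 2.
Proof.
have l2 : 0 <= ell 2 by apply: ell_ge0.
elim/ltn_ind: n => n IH; have [n2|n2] := leqP n 2.
  have psi0 m : (m <= 1)%N -> psi m <= 0.
    move=> m1; rewrite /psi /mangoldt_sum big1 // => p pr_p; rewrite big_nat_cond big1 // => k /andP[/andP[k0 _] _].
    rewrite leqNgt (leq_ltn_trans m1) ?mulr0 //.
    by rewrite (leq_trans (prime_gt1 pr_p)) // -[X in (X <= _)%N]expn1 leq_exp2l ?prime_gt1.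
  have [n1|n1] := leqP n 1; first by apply: le_trans (psi0 _ n1) _; rewrite !mulr_ge0.
  have -> : n = 2%N by lia.
  by have := psi_double 1; have := psi0 1%N isT; rewrite (_ : 1.*2 = 2)%N //; lra.
pose h := uphalf n; have hn : (h < n)%N by rewrite /h; lia.
have nh : (n <= h.*2)%N by rewrite /h; lia.
have := psi_le nh; have := psi_double h; have := IH h hn => h1 h2 h3.
(* Origin of the constant 4: 2h <= n + 1, and 3(n + 1) <= 4n from n = 3 on. *)
have h4 : 3 * h.*2%:R <= 4 * n%:R :> R by rewrite -!natrM ler_nat /h; lia.
have h5 : 4 * h%:R = 2 * h.*2%:R :> R by rewrite -!natrM -muln2; congr (_%:R); lia.
rewrite h5 in h1; have : 3 * h.*2%:R * ell 2 <= 4 * n%:R * ell 2 by rewrite ler_wpM2r.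
lra.
Qed.

End VonMangoldt.

(** * Primes with prescribed quadratic characters *)

Section QuadraticDirichlet.
Variables (R : archiRealFieldType) (ell : nat -> R).
Hypotheses (ellM : forall m n, (0 < m)%N -> (0 < n)%N -> ell (m * n)%N = ell m + ell n)
  (ell_homo : forall m n, (0 < m <= n)%N -> ell m <= ell n)
  (ell_step : forall n, (0 < n)%N -> n%:R * (ell n.+1 - ell n) <= 1)
  (ell_unbounded : forall C, exists2 n, (0 < n)%N & C < ell n).

Let ell_ge0 := ell_ge0 ellM ell_homo.

Definition char_sum (chi : nat -> R) x := mangoldt_sum ell x (fun d => (d <= x)%N%:R * (chi d / d%:R)).

Section NonPrincipal.
Variables (chi : nat -> R) (N : nat).
Hypotheses (N0 : (0 < N)%N) (chi_per : forall n, chi (n + N)%N = chi n)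
  (chi_sum : \sum_(i < N) chi i = 0)
  (chiM : forall m n, chi (m * n)%N = chi m * chi n)
  (chi1 : chi 1%N = 1) (chi_val : forall n, [\/ chi n = 0, chi n = 1 | chi n = -1]).

Let chi_le1 n : `|chi n| <= 1.
Proof. by case: (chi_val n) => ->; rewrite ?normr0 ?normrN ?normr1. Qed.

Lemma chi_ell_bound : exists C, forall x, `|\sum_(1 <= n < x.+1) chi n / n%:R * ell n| <= C.
Proof.
(* log n / n is known to decrease once log n >= 1, so Abel summation starts at a; the earlier terms
   are bounded trivially. *)
have [a a0 la] := ell_unbounded 1.
exists (\sum_(1 <= n < a) ell n + N%:R * (ell a / a%:R)) => x.
have head y : `|\sum_(1 <= n < y) chi n / n%:R * ell n| <= \sum_(1 <= n < y) ell n.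
  apply: le_trans (ler_norm_sum _ _ _) _; apply: ler_sum_nat => n /andP[n0 _].
  rewrite normrM (ger0_norm (ell_ge0 n0)) ler_piMl ?ell_ge0 // normrM.
  rewrite mulr_ile1 // ger0_norm ?invr_ge0 // invf_le1 ?ltr0n // ler1n //.
have [xa|ax] := ltnP x.+1 a.
  apply: le_trans (head _) _; rewrite (@big_cat_nat _ _ _ x.+1 1 a) //=; last exact: ltnW.
  rewrite -addrA ler_wpDr // addr_ge0 //.
    by rewrite big_nat_cond sumr_ge0 // => n /andP[/andP[xn _] _]; apply: ell_ge0; lia.
  by rewrite mulr_ge0 ?divr_ge0 ?ell_ge0.
rewrite (@big_cat_nat _ _ _ a 1 x.+1) //=; apply: le_trans (ler_normD _ _) (lerD (head a) _).
rewrite (eq_bigr (fun n => chi n * (ell n / n%:R))) => [|n _]; last by rewrite mulrAC mulrA.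
apply: (@abel_bound _ chi (fun n => ell n / n%:R) N%:R) => [c _|n an|n an].
- exact: chi_sum_bound.
- by rewrite divr_ge0 ?ell_ge0 //; lia.
have n0 : (0 < n)%N by lia.
have l1 : ell a <= ell n by rewrite ell_homo ?a0.
have := ell_step n0; have nR : 0 < n%:R :> R by rewrite ltr0n.
rewrite ler_pdivrMr ?ltr0n // -natr1 mulrAC ler_pdivlMr //; lra.
Qed.

(* Shapiro's argument: [Lsum chi x * char_sum chi x] differs from the bounded sum
   of [chi n / n * ell n] by [O (psi x / x)]. *)
Lemma char_sum_bounded : exists C K0, forall x, (K0 <= x)%N -> `|char_sum chi x| <= C.
Proof.
have [C hC] := chi_ell_bound.
have [c c0 [K0 hK]] := Lsum_nonvanishing N0 chi_per chi_sum chi_le1 chiM chi1 chi_val.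
exists ((C + 4 * N%:R * ell 2) / c), K0.+1 => x Kx; have x0 : (0 < x)%N by lia.
have xR : 0 < x%:R :> R by rewrite ltr0n.
have key : `|Lsum chi x * char_sum chi x - \sum_(1 <= n < x.+1) chi n / n%:R * ell n| <= 4 * N%:R * ell 2.
  rewrite (mangoldt_sum_conv ellM) /char_sum -mangoldt_sum_scale -[X in _ - X]mul1r -mulNr -mangoldt_sum_scale -mangoldt_sum_add.
  apply: le_trans (mangoldt_sum_norm ellM ell_homo _ _) _.
  apply: (@le_trans _ _ (mangoldt_sum ell x (fun d => N%:R / x%:R * (d <= x)%N%:R))).
    apply: (mangoldt_sum_le ellM ell_homo) => d d0; have dR : 0 < d%:R :> R by rewrite ltr0n.
    have -> : \sum_(1 <= m < (x %/ d).+1) chi (d * m)%N / (d * m)%N%:R = chi d / d%:R * Lsum chi (x %/ d).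
      rewrite /Lsum big_distrr /=; apply: eq_bigr => m _.
      by rewrite chiM natrM invfM mulrACA.
    have [dx|xd] := leqP d x; last first.
      rewrite divn_small // (_ : Lsum chi 0 = 0); last by rewrite /Lsum big_geq.
      by rewrite !(mulr0, mul0r) addr0 normr0.
    rewrite mul1r mulr1 mulN1r mulrC -mulrBr normrM normrM (ger0_norm (_ : 0 <= d%:R^-1)) ?invr_ge0 //.
    (* The error at d is at most N / (d (x %/ d + 1)) <= N / x, uniformly in d; summed against
       Lambda it is at most (N / x) psi x, which Chebyshev bounds. *)
    have h := Lsum_diff N0 chi_per chi_sum chi_le1 (leq_div x d).
    apply: le_trans (_ : 1 * d%:R^-1 * (N%:R / (x %/ d).+1%:R) <= _).
      by rewrite ler_pM // ?mulr_ge0 ?invr_ge0 // ler_wpM2r ?invr_ge0.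
    rewrite mul1r mulrCA -invfM -natrM ler_wpM2l // lef_pV2 ?posrE ?ltr0n ?muln_gt0 ?d0 //.
    by rewrite ler_nat ltnW // mulnC ltn_ceil.
  rewrite mangoldt_sum_scale -/(psi ell x); apply: (@le_trans _ _ (N%:R / x%:R * (4 * x%:R * ell 2))).
    by rewrite ler_wpM2l ?divr_ge0 // (chebyshev ellM ell_homo).
  by rewrite le_eqVlt; apply/orP; left; apply/eqP; field; rewrite gt_eqF.
have hL := hK x (ltnW Kx); have := hC x; move: key.
set S := \sum_(_ <= _ < _) _ => h1 h2.
have h3 : `|Lsum chi x * char_sum chi x| <= C + 4 * N%:R * ell 2.
  have := ler_normD (Lsum chi x * char_sum chi x - S) S; rewrite subrK; lra.
rewrite ler_pdivlMr //; apply: le_trans h3; rewrite normrM mulrC ler_wpM2r //.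
Qed.

End NonPrincipal.

(** Mertens' bound minus the prime powers not coprime to N: a prime p dividing N costs at most log
    p, as the sum of the p^-k is at most 1. *)
Lemma char_sum_principal N : (0 < N)%N -> exists C, forall x, (0 < x)%N ->
  ell x - C <= char_sum (fun d => (coprime N d)%:R) x.
Proof.
move=> N0; exists (1 + \sum_(1 <= p < N.+1) ell p) => x x0.
have h := mertens ellM ell_homo ell_step x0.
have e : mangoldt_sum ell x (fun d => (d <= x)%N%:R / d%:R) = char_sum (fun d => (coprime N d)%:R) x +
    mangoldt_sum ell x (fun d => (d <= x)%N%:R * ((~~ coprime N d)%:R / d%:R)).
  rewrite /char_sum -mangoldt_sum_add; apply: (mangoldt_sum_ext ellM ell_homo) => d _.
  by rewrite -mulrDr -mulrDl -natrD; case: coprime; rewrite ?addn0 ?add0n mul1r.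
suff : mangoldt_sum ell x (fun d => (d <= x)%N%:R * ((~~ coprime N d)%:R / d%:R)) <= \sum_(1 <= p < N.+1) ell p.
  by move: h; rewrite e; lra.
apply: (@le_trans _ _ (mangoldt_sum ell x (fun d => (~~ coprime N d)%:R / d%:R))).
  apply: (mangoldt_sum_le ellM ell_homo) => d d0; rewrite ler_piMl ?divr_ge0 //.
  by case: (_ <= _)%N.
rewrite /mangoldt_sum.
have geo p : (1 < p)%N -> \sum_(1 <= k < x.+1) (p ^ k)%N%:R^-1 <= 1 :> R.
  move=> p1; suff : \sum_(1 <= k < x.+1) (p ^ k)%N%:R^-1 <= 1 - 2 ^- x :> R.
    by have : 0 < 2 ^- x :> R; [rewrite invr_gt0 exprn_gt0|lra].
  elim: (x) => [|y IH]; first by rewrite big_geq // expr0 invr1 subrr.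
  rewrite big_nat_recr //=; have : (p ^ y.+1)%N%:R^-1 <= 2 ^- y.+1 :> R.
    rewrite lef_pV2; first by rewrite -natrX ler_nat leq_exp2r.
      by rewrite posrE ltr0n expn_gt0 ltnW.
    by rewrite posrE exprn_gt0.
  have : 2 ^- y = 2 * 2 ^- y.+1 :> R by rewrite exprS invfM mulrA divff ?mul1r // pnatr_eq0.
  lra.
apply: (@le_trans _ _ (\sum_(1 <= p < x.+1 | prime p) (p <= N)%N%:R * ell p)).
  rewrite big_nat_cond [leRHS]big_nat_cond; apply: ler_sum => p /andP[/andP[p0 px] pr_p].
  have [pN|pN] := boolP (p %| N)%N; last first.
    rewrite big_nat_cond big1 ?mulr_ge0 ?ell_ge0 // => k /andP[/andP[k0 _] _].
    by rewrite coprimeXr ?mul0r ?mulr0 // coprime_sym prime_coprime.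
  rewrite (dvdn_leq N0 pN) mul1r -big_distrr /=.
  rewrite ler_piMr ?ell_ge0 //; apply: le_trans (geo p (prime_gt1 pr_p)).
  by apply: ler_sum => k _; rewrite ler_piMl ?invr_ge0 //; case: coprime.
rewrite big_mkcond /=; have [xN|Nx] := leqP x N.
  rewrite (@big_cat_nat _ _ _ x.+1 1 N.+1) //= ler_wpDr //.
    by rewrite big_nat_cond sumr_ge0 // => n /andP[/andP[xn _] _]; apply: ell_ge0; lia.
  apply: ler_sum_nat => p /andP[p0 _]; case: ifP => _; last exact: ell_ge0.
  by case: leqP; rewrite ?mul1r ?mul0r ?ell_ge0.
rewrite (@big_cat_nat _ _ _ N.+1 1 x.+1) //=; last exact: ltnW.
rewrite [X in _ + X]big_nat_cond [X in _ + X]big1 ?addr0; last first.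
  by move=> p /andP[/andP[Np _] _]; rewrite leqNgt Np mul0r if_same.
apply: ler_sum_nat => p /andP[p0 _]; case: ifP => _; last exact: ell_ge0.
by case: leqP; rewrite ?mul1r ?mul0r ?ell_ge0.
Qed.

Lemma mangoldt_sum_sum (J : finType) x (F : J -> nat -> R) :
  mangoldt_sum ell x (fun d => \sum_j F j d) = \sum_j mangoldt_sum ell x (F j).
Proof.
rewrite /mangoldt_sum [RHS]exchange_big /=; apply: eq_bigr => p _; rewrite [RHS]exchange_big /=.
by apply: eq_bigr => k _; rewrite mulr_sumr.
Qed.

Section Classes.
Variables (I : finType) (b : I -> nat -> bool) (N : nat).
Hypotheses (N0 : (0 < N)%N)
  (bM : forall i m n, coprime N m -> coprime N n -> b i (m * n) = b i m (+) b i n)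
  (b_per : forall i n, b i (n + N) = b i n)
  (b_surj : forall v : I -> bool, exists2 n, coprime N n & forall i, b i n = v i).

Let bit (J : {set I}) n := \big[addb/false]_(i in J) b i n.
(** The real characters generated by the bits, indexed by subsets of I; the empty set gives the
    principal one. *)
Let chi (J : {set I}) n : R := (coprime N n)%:R * (-1) ^+ bit J n.

Let chiM J m n : chi J (m * n) = chi J m * chi J n.
Proof.
rewrite /chi coprimeMr; case: (boolP (coprime N m)) => cm; last by rewrite !mul0r.
case: (boolP (coprime N n)) => cn; last by rewrite !mul0r mulr0.
rewrite !mul1r -signr_addb; congr (_ ^+ _); rewrite /bit -big_split /=.
by congr nat_of_bool; apply: eq_bigr => i _; rewrite bM.
Qed.

Let b1 i : b i 1 = false.
Proof. by have := @bM i 1 1; rewrite coprimen1 mul1n => /(_ isT isT); case: (b i 1). Qed.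

Let chi1 J : chi J 1 = 1.
Proof. by rewrite /chi coprimen1 /bit big1 ?mulr1 // => i _; rewrite b1. Qed.

Let coprime_per n : coprime N (n + N) = coprime N n.
Proof. by rewrite /coprime gcdnDr. Qed.

Let chi_per J n : chi J (n + N) = chi J n.
Proof.
rewrite /chi coprime_per; congr (_ * _ ^+ _); congr nat_of_bool.
by apply: eq_bigr => i _; rewrite b_per.
Qed.

Let chi_mod J n : chi J (n %% N) = chi J n.
Proof.
rewrite [in RHS](divn_eq n N) addnC; elim: (n %/ N)%N => [|q IH]; first by rewrite addn0.
by rewrite mulSn [(N + _)%N]addnC addnA chi_per.
Qed.

Let chi_val J n : [\/ chi J n = 0, chi J n = 1 | chi J n = -1].
Proof.
rewrite /chi; case: coprime; last by rewrite mul0r; constructor 1.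
by rewrite mul1r; case: bit; [constructor 3|constructor 2].
Qed.

(** Joint surjectivity provides n with chi n = -1, and multiplication by n permutes the residues, so
    the sum equals its opposite. *)
Let chi_sum (J : {set I}) : J != set0 -> \sum_(i < N) chi J i = 0.
Proof.
case/set0Pn => j jJ; have [n cn hn] := b_surj (fun i => i == j).
have cE : chi J n = -1.
  rewrite /chi cn mul1r /bit (bigD1 j) //= hn eqxx big1 // => i /andP[_ /negbTE ij].
  by rewrite hn.
pose f (i : 'I_N) : 'I_N := Ordinal (ltn_pmod (n * i) N0).
have f_inj : injective f.
  move=> i k /(congr1 val) /= /eqP h; apply/val_inj => /=; wlog ik : i k h / (i <= k)%N.
    by move=> W; case: (leqP i k) => [|/ltnW]; [exact: W | move=> ki; apply/esym; apply: W; rewrite 1?eq_sym].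
  move: h; rewrite eq_sym eqn_mod_dvd ?leq_mul2l ?ik ?orbT // -mulnBr Gauss_dvdr //.
  move: ik; rewrite leq_eqVlt => /orP[/eqP //|ik /dvdn_leq].
  by rewrite subn_gt0 => /(_ ik); have := ltn_ord k; lia.
have : \sum_(i < N) chi J i = - \sum_(i < N) chi J i.
  rewrite {1}(reindex_inj f_inj) /= -sumrN; apply: eq_bigr => i _.
  by rewrite chi_mod chiM cE mulN1r.
by set S := \sum_(_ < _) _; lra.
Qed.

(** Orthogonality by expanding a product over subsets: a factor vanishes as soon as one bit differs
    from v. *)
Let indicator (v : I -> bool) n :
  \sum_(J : {set I}) (-1) ^+ (\big[addb/false]_(i in J) v i) * chi J n =
  (coprime N n)%:R * \prod_i (1 + (-1) ^+ (v i (+) b i n)).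
Proof.
rewrite (eq_bigr (fun i => (-1) ^+ (v i (+) b i n) + 1)) => [|i _]; last by rewrite addrC.
rewrite (bigA_distr (R := R)) /= big_distrr /=; apply: eq_bigr => J _.
rewrite /chi mulrCA; congr (_ * _); rewrite -big_mkcond /= -signr_addb.
rewrite /bit -big_split /=; elim/big_rec2: _ => [|i x y _ <-]; first by [].
by rewrite signr_addb.
Qed.

(* An even prime power has trivial bits and an odd one those of its prime, so for a
   nontrivial class no higher prime power has to be discarded. *)
Lemma prime_in_class (v : I -> bool) : (exists i, v i) ->
  exists2 q, prime q && coprime N q & forall i, b i q = v i.
Proof.
move=> [i0 vi0].
have [C0 hC0] := char_sum_principal N0.
have /fin_all_exists[CK hCK] (J : {set I}) : exists CK : R * nat,
    J != set0 -> forall x, (CK.2 <= x)%N -> `|char_sum (chi J) x| <= CK.1.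
  have [->|J0] := eqVneq J set0; first by exists (0, 0%N).
  have [C [K h]] := char_sum_bounded N0 (chi_per J) (chi_sum J0) (chiM J) (chi1 J) (chi_val J).
  by exists (C, K).
(* Beyond this C, the logarithm in the principal sum outweighs the bounded contributions of all the
   other characters. *)
pose C := C0 + \sum_(J | J != set0) (CK J).1; pose K := \max_J (CK J).2.
have [y y0 hy] := ell_unbounded C.
pose x := maxn y K; have x0 : (0 < x)%N by rewrite leq_max y0.
have lx : C < ell x by apply: lt_le_trans hy _; rewrite ell_homo // y0 leq_maxl.
pose F d := \sum_(J : {set I}) (-1) ^+ (\big[addb/false]_(i in J) v i) * ((d <= x)%N%:R * (chi J d / d%:R)).
have FE d : F d = (d <= x)%N%:R / d%:R * ((coprime N d)%:R * \prod_i (1 + (-1) ^+ (v i (+) b i d))).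
  rewrite -indicator big_distrr /=; apply: eq_bigr => J _.
  by move: (_ ^+ _) ((d <= x)%N%:R) (chi J d) (d%:R^-1) => *; ring.
have F0 : 0 < mangoldt_sum ell x F.
  rewrite /F mangoldt_sum_sum (bigD1 set0) //= big_set0 expr0.
  have -> : mangoldt_sum ell x (fun d => 1 * ((d <= x)%N%:R * (chi set0 d / d%:R))) =
      char_sum (fun d => (coprime N d)%:R) x.
    apply: (mangoldt_sum_ext ellM ell_homo) => d _; rewrite mul1r /chi /bit big_set0 expr0 mulr1 //.
  have : - \sum_(J | J != set0) (CK J).1 <= \sum_(J : {set I} | J != set0)
      mangoldt_sum ell x (fun d => (-1) ^+ (\big[addb/false]_(i in J) v i) * ((d <= x)%N%:R * (chi J d / d%:R))).
    rewrite -sumrN; apply: ler_sum => J J0; rewrite mangoldt_sum_scale -/(char_sum (chi J) x).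
    have : `|char_sum (chi J) x| <= (CK J).1.
      by apply: hCK => //; rewrite leq_max (leq_bigmax J) orbT.
    by rewrite ler_norml => /andP[h1 h2]; case: (\big[_/_]_(_ in _) _); rewrite ?expr0 ?expr1; lra.
  by have := hC0 x x0; move: lx; rewrite /C; lra.
case: (boolP [exists q : 'I_x.+1, [&& prime q, coprime N q & [forall i, b i q == v i]]]).
  case/existsP => q /and3P[pr_q cq /forallP hq]; exists (nat_of_ord q); first by rewrite pr_q.
  by move=> i; apply/eqP.
rewrite negb_exists => /forallP hq; move: F0; rewrite /mangoldt_sum big_nat_cond big1 ?ltxx // => p.
move=> /andP[/andP[p0 px] pr_p]; rewrite big_nat_cond big1 // => k /andP[/andP[k0 _] _].
rewrite FE; case: (boolP (coprime N (p ^ k))) => [|_]; last by rewrite mul0r !mulr0.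
rewrite coprime_pexpr // => cp.
suff /existsP[i hi] : [exists i, b i (p ^ k) != v i].
  rewrite (bigD1 i) //= (_ : v i (+) b i (p ^ k) = true) ?expr1 ?subrr ?mul0r ?mulr0 //.
  by move: hi; case: (v i); case: (b i _).
rewrite -[X in is_true X]negbK negb_exists; apply/negP => /forallP hall.
have bX i m : b i (p ^ m) = odd m && b i p.
  elim: m => [|m IH]; first by rewrite b1.
  by rewrite expnS bM ?coprimeXr // IH /=; case: (odd m); case: (b i p).
have ok : odd k by have := hall i0; rewrite negbK bX vi0 => /eqP /andP[].
have := hq (Ordinal px); rewrite pr_p cp /= => /negP; apply; apply/forallP => i.
by have := hall i; rewrite negbK bX ok.
Qed.
End Classes.
End QuadraticDirichlet.

(** * The real logarithm on positive integers *)

Section LnNat.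
Variable R : realType.
Let ell (n : nat) : R := ln n%:R.

Lemma ln_natM m n : (0 < m)%N -> (0 < n)%N -> ell (m * n) = ell m + ell n.
Proof. by move=> m0 n0; rewrite /ell natrM lnM ?posrE ?ltr0n. Qed.

Lemma ln_nat_homo m n : (0 < m <= n)%N -> ell m <= ell n.
Proof. by move=> /andP[m0 mn]; rewrite ler_ln ?posrE ?ltr0n ?ler_nat // (leq_trans m0). Qed.

Lemma ln_nat_step n : (0 < n)%N -> n%:R * (ell n.+1 - ell n) <= 1.
Proof.
move=> n0; have nR : 0 < n%:R :> R by rewrite ltr0n.
rewrite /ell -ln_div ?posrE ?ltr0n // -natr1 mulrDl divff ?gt_eqF // mul1r.
rewrite mulrC -ler_pdivlMr // mul1r le_ln1Dx // (@lt_trans _ _ 0) ?ltrN10 // invr_gt0 //.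
Qed.

Lemma ln_nat_unbounded C : exists2 n, (0 < n)%N & C < ell n.
Proof.
exists (Num.bound (expR C)).+1 => //; rewrite /ell -[ltLHS]expRK ltr_ln ?posrE ?expR_gt0 ?ltr0n //.
apply: lt_trans (archi_boundP (expR_ge0 _)) _; by rewrite ltr_nat.
Qed.

End LnNat.

(** * Quadratic symbols at odd primes and characters modulo 8 *)

Lemma nonres_modn p n : prime p -> nonres p (n %% p)%N = nonres p n.
Proof.
move=> pr_p; rewrite /nonres; suff -> : ((n %% p)%N%:Z%:~R = n%:Z%:~R :> 'F_p) by [].
by rewrite -!pmulrn Fp_nat_mod.
Qed.

Lemma coprime_modulus (S : seq nat) n :
  coprime (8 * \prod_(i <- S) i) n = odd n && all (fun p => coprime p n) S.
Proof.
rewrite coprimeMl (coprime_pexpl 2 n (isT : (0 < 3)%N)) coprime2n; congr (_ && _).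
elim: S => [|p S IH]; first by rewrite big_nil coprime1n.
by rewrite big_cons coprimeMl /= IH.
Qed.

Lemma crt_bits (S : seq nat) (r : nat) (e : nat -> bool) : uniq S -> odd r ->
  (forall p, p \in S -> prime p && odd p) ->
  exists2 n, coprime (8 * \prod_(i <- S) i) n & n = r %[mod 8] /\ forall p, p \in S -> nonres p n = e p.
Proof.
elim: S => [_ or_ _|p S IH /= /andP[pS uS] or_ hS].
  by exists r; rewrite ?coprime_modulus ?andbT.
have /andP[pr_p odd_p] := hS p (mem_head _ _).
have hS' q : q \in S -> prime q && odd q by move=> qS; apply: hS; rewrite in_cons qS orbT.
have [n' cn' [n8 hn']] := IH uS or_ hS'.
have [m pm hm] : exists2 m, coprime p m & nonres p m = e p.
  case: (e p); first by have [m /andP[pm hm]] := nonres_exists pr_p odd_p; exists m; rewrite ?prime_coprime.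
  by exists 1%N; [exact: coprimen1 | exact: nonres1].
set N' := (8 * \prod_(i <- S) i)%N in cn'.
have cop : coprime N' p.
  rewrite coprime_modulus odd_p; apply/allP => q qS; have /andP[pr_q _] := hS' q qS.
  by rewrite prime_coprime // dvdn_prime2 //; apply: contraNneq pS => <-.
set x := chinese N' p n' m.
have xN : x = n' %[mod N'] by apply: chinese_modl.
have xp : x = m %[mod p] by apply: chinese_modr.
have modD (d : nat) : (d %| N')%N -> x = n' %[mod d].
  by move=> dN; rewrite -(modn_dvdm x dN) xN modn_dvdm.
have cx : coprime N' x by rewrite coprime_sym -coprime_modl xN coprime_modl coprime_sym.
exists x; last split.
- rewrite coprime_modulus /=; move: cx; rewrite coprime_modulus => /andP[-> ->]; rewrite andbT /=.
  by rewrite coprime_sym -coprime_modl xp coprime_modl coprime_sym.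
- by rewrite modD // dvdn_mulr.
- move=> q; rewrite in_cons => /orP[/eqP ->|qS]; first by rewrite -nonres_modn // xp nonres_modn.
  have /andP[pr_q _] := hS' q qS.
  rewrite -nonres_modn // modD ?nonres_modn ?hn' //.
  by rewrite /N' (big_rem q) //= mulnCA dvdn_mulr.
Qed.

Theorem prime_quadratic_symbols (S : seq nat) (e : nat -> bool) (e4 e8 : bool) :
  (forall p, p \in S -> prime p && odd p) ->
  exists q : nat, [/\ prime q, odd q & q \notin S] /\
    [/\ (forall p, p \in S -> nonres p q = e p), (q %% 4 == 3)%N = e4 &
        ((q %% 8 == 3) || (q %% 8 == 5))%N = e8].
Proof.
move=> hS.
(* [prime_in_class] needs a class with some bit set, while e, e4 and e8 may all be false. The extra
   prime p0, whose bit is forced to be true, ensures this. *)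
pose M := \max_(p <- S) p; have [p0 Mp0 pr_p0] := prime_above (maxn 2 M).
have p0S : p0 \notin S.
  apply/negP => h; have : (p0 <= M)%N by rewrite /M (big_rem p0) //= leq_maxl.
  by move: Mp0; rewrite gtn_max; lia.
have odd_p0 : odd p0.
  by have [p2|//] := even_prime pr_p0; move: Mp0; rewrite p2 gtn_max.
pose T := undup (p0 :: S).
have hT p : p \in T -> prime p && odd p.
  by rewrite mem_undup in_cons => /orP[/eqP ->|]; [rewrite pr_p0 | exact: hS].
pose I := option (option 'I_(size T)).
pose t (i : 'I_(size T)) := nth 0%N T i.
have tT i : t i \in T by rewrite mem_nth.
pose b (i : I) (n : nat) : bool := match i with
  | None => (n %% 4 == 3)%N
  | Some None => ((n %% 8 == 3) || (n %% 8 == 5))%N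
  | Some (Some j) => nonres (t j) n end.
pose N := (8 * \prod_(p <- T) p)%N.
have N0 : (0 < N)%N.
  by rewrite muln_gt0 /= big_seq; apply: prodn_cond_gt0 => p /hT /andP[/prime_gt0].
have tN i : (t i %| N)%N by rewrite /N (big_rem (t i)) //= mulnCA dvdn_mulr.
have bM i m n : coprime N m -> coprime N n -> b i (m * n) = b i m (+) b i n.
  rewrite !coprime_modulus => /andP[om /allP am] /andP[on /allP an]; case: i => [[i|]|] /=.
  - have /andP[pr_i odd_i] := hT _ (tT i).
    by rewrite PoszM nonresM // absz_nat -prime_coprime // ?am ?an.
  - rewrite -modnMm.
    have : (m %% 8 = 1 \/ m %% 8 = 3 \/ m %% 8 = 5 \/ m %% 8 = 7)%N by lia.
    have : (n %% 8 = 1 \/ n %% 8 = 3 \/ n %% 8 = 5 \/ n %% 8 = 7)%N by lia.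
    by case=> [->|[->|[->|->]]]; case=> [->|[->|[->|->]]].
  - rewrite -modnMm.
    have : (m %% 4 = 1 \/ m %% 4 = 3)%N by lia.
    have : (n %% 4 = 1 \/ n %% 4 = 3)%N by lia.
    by case=> ->; case=> ->.
have b_per i n : b i (n + N) = b i n.
  have modN d : (d %| N)%N -> n + N = n %[mod d] by move=> /eqP dN; rewrite -modnDmr dN addn0.
  case: i => [[i|]|] /=.
  - by have /andP[pr_i _] := hT _ (tT i); rewrite -nonres_modn // modN // nonres_modn.
  - by rewrite !modN // dvdn_mulr.
  - by rewrite !modN // /N -[8%N]/(4 * 2)%N -mulnA dvdn_mulr.
have b_surj (v : I -> bool) : exists2 n, coprime N n & forall i, b i n = v i.
  (* The residues 3, 7, 5, 1 modulo 8 realise the four pairs of bits (3 mod 4, 3 or 5 mod 8). *)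
  pose r := if v None then (if v (Some None) then 3 else 7)%N else (if v (Some None) then 5 else 1)%N.
  pose e' p := if insub (index p T) is Some j then v (Some (Some j)) else false.
  have or_ : odd r by rewrite /r; case: (v None); case: (v (Some None)).
  have [n cn [n8 hn]] := crt_bits e' (undup_uniq _) or_ hT.
  exists n => // -[[i|]|] /=.
  - rewrite hn // /e' index_uniq ?undup_uniq // ; case: insubP => [j _ jE|]; last by rewrite ltn_ord.
    by congr (v (Some (Some _))); apply: val_inj.
  - by rewrite n8 /r; case: (v None); case: (v (Some None)).
  - have -> : (n %% 4 = r %% 4)%N by rewrite -(@modn_dvdm 8) // n8 modn_dvdm.
    by rewrite /r; case: (v None); case: (v (Some None)).
pose v (i : I) : bool := match i with
  | None => e4 | Some None => e8 | Some (Some j) => (t j == p0) || e (t j) end.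
have [|q /andP[pr_q cq] hq] := @prime_in_class (Rdefinitions.R : realType) (fun n => ln n%:R)
  (@ln_natM _) (@ln_nat_homo _) (@ln_nat_step _) (@ln_nat_unbounded _) I b N N0 bM b_per b_surj v.
  have p0T : p0 \in T by rewrite mem_undup mem_head.
  have lt : (index p0 T < size T)%N by rewrite index_mem.
  by exists (Some (Some (Ordinal lt))); rewrite /= /t /= nth_index // eqxx.
move: cq; rewrite coprime_modulus => /andP[oq /allP aq].
exists q; split; split => //.
- apply/negP => qS; have := aq q; rewrite mem_undup in_cons qS orbT => /(_ isT).
  by rewrite /coprime gcdnn; case: eqP pr_q => // ->.
- move=> p pS; have pT : p \in T by rewrite mem_undup in_cons pS orbT.
  have lt : (index p T < size T)%N by rewrite index_mem.
  have := hq (Some (Some (Ordinal lt))); rewrite /= /t /= nth_index // => ->.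
  by case: eqP pS => // ->; rewrite (negbTE p0S).
- exact: hq None.
- exact: hq (Some None).
Qed.

(** * From local to global solutions *)

Lemma hilbert_last (x y : int) q : x != 0 -> y != 0 -> prime q -> odd q ->
  (forall l, prime l -> odd l -> l != q -> hilbert l x y = false) ->
  hilbert2 x y = false -> hilbert_oo x y = false ->
  forall l, prime l -> odd l -> hilbert l x y = false.
Proof.
move=> x0 y0 pr_q odd_q h h2 hoo l pr_l odd_l.
have [->|/h->//] := eqVneq l q.
pose B := (maxn q (maxn `|x| `|y|)).+1.
have := @product_formula B x y x0 y0; rewrite /hilbert_sum h2 hoo !addbF.
rewrite (@big_addb_single _ (fun l => hilbert l x y) q) //; first by apply; rewrite ltnS !leq_max leqnn ?orbT.
by rewrite ltnS leq_maxl.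
Qed.

Lemma int_with_valuations (S : seq nat) (vals : nat -> bool) (v2 sgn : bool) : uniq S ->
  (forall p, p \in S -> prime p && odd p) ->
  exists c : int, [/\ c != 0, val_odd 2 c = v2, (c < 0) = sgn,
    (forall p, p \in S -> val_odd p c = vals p) &
    (forall l, prime l -> odd l -> l \notin S -> ~~ (l %| `|c|)%N)].
Proof.
elim: S => [_ _|p S IH /= /andP[pS uS] hS].
  exists ((-1) ^+ sgn * 2 ^+ v2); split => //.
  - by case: sgn; case: v2.
  - rewrite val_oddM; first by case: sgn; case: v2; rewrite ?expr0 ?expr1 ?val_oddN1 ?(@val_odd_prime 2) // ?(@val_odd_ndvd 2 1).
      by case: sgn.
    by case: v2.
  - by case: sgn; case: v2.
  - move=> l pr_l odd_l _; rewrite abszM abszX abszN1 exp1n mul1n abszX.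
    by case: v2; rewrite ?dvdn1 ?dvdn_prime2 //; [case: eqP odd_l => // -> | case: eqP pr_l => // ->].
have /andP[pr_p odd_p] := hS p (mem_head _ _).
have [|c [c0 cv2 csg cS cl]] := IH uS; first by move=> q qS; apply: hS; rewrite in_cons qS orbT.
have pp0 : p%:Z != 0 by rewrite -lt0n prime_gt0.
have vpc : val_odd p c = false by apply: val_odd_ndvd; apply: cl.
have [vp|vp] := boolP (vals p); last first.
  exists c; split => // [q|l pr_l odd_l]; rewrite in_cons; first by case/orP => [/eqP ->|/cS //]; rewrite vpc (negbTE vp).
  by rewrite negb_or => /andP[_]; apply: cl.
exists (p%:Z * c); split.
- by rewrite mulf_neq0.
- by rewrite val_oddM // val_odd2_odd.
- by rewrite pmulr_rlt0 // ltz_nat prime_gt0.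
- move=> q; rewrite in_cons => /orP[/eqP ->|qS]; first by rewrite val_oddM // vpc val_odd_prime // vp.
  have /andP[pr_q _] : prime q && odd q by apply: hS; rewrite in_cons qS orbT.
  rewrite val_oddM // cS // val_odd_ndvd //; apply: prime_ndvd => //.
  by apply: contraNneq pS => <-.
- move=> l pr_l odd_l; rewrite in_cons negb_or => /andP[lp lS].
  by rewrite abszM Euclid_dvdM // negb_or cl // andbT prime_ndvd.
Qed.

(** t = c q, where c fixes the sign and the valuations and the prime q corrects the residue bits and
    the class modulo 8. Away from S and 2, only q divides t. *)
Lemma int_with_local_classes (S : seq nat) (vals res : nat -> bool) (v2 e4 e8 sgn : bool) : uniq S ->
  (forall p, p \in S -> prime p && odd p) ->
  exists (t : int) (q : nat), [/\ t != 0, prime q, odd q & q \notin S] /\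
    [/\ val_odd 2 t = v2, eps2 t = e4, omega2 t = e8 & (t < 0) = sgn] /\
    (forall p, p \in S -> val_odd p t = vals p /\ res_bit p t = res p) /\
    (forall l, prime l -> odd l -> l \notin S -> l != q -> ~~ (l %| `|t|)%N).
Proof.
move=> uS hS; have [c [c0 cv2 csg cS cl]] := int_with_valuations vals v2 sgn uS hS.
have [q [[pr_q odd_q qS] [hq q4 q8]]] :=
  prime_quadratic_symbols (fun p => res p (+) res_bit p c) (e4 (+) eps2 c) (e8 (+) omega2 c) hS.
have q0 : q%:Z != 0 by rewrite -lt0n prime_gt0.
exists (c * q%:Z), q; split; first by split => //; rewrite mulf_neq0.
split; last split.
- split.
  + by rewrite val_oddM // (val_odd2_odd odd_q) addbF.
  + by rewrite eps2M // eps2_odd // q4 addbCA addbb addbF.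
  + by rewrite omega2M // omega2_odd // q8 addbCA addbb addbF.
  + by rewrite pmulr_llt0 // ltz_nat prime_gt0.
- move=> p pS; have /andP[pr_p odd_p] := hS p pS.
  have pq : p != q by apply: contraNneq qS => <-.
  split; first by rewrite val_oddM // cS // val_odd_ndvd ?addbF //; apply: prime_ndvd.
  by rewrite res_bitM // res_bit_prime // hq // addbCA addbb addbF.
- move=> l pr_l odd_l lS lq; rewrite abszM Euclid_dvdM // negb_or cl //=.
  exact: prime_ndvd.
Qed.

(* Square classes of Q_p (valuation parity, residue bit) and of Q_2 (valuation parity, eps, omega). *)
Definition cls := (bool * bool)%type.
Definition cls_add (x y : cls) : cls := (x.1 (+) y.1, x.2 (+) y.2).
Definition cls_hilbert (e : bool) (x y : cls) : bool :=
  (x.1 && y.1 && e) (+) (x.1 && y.2) (+) (y.1 && x.2).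
Definition cls2 := (bool * bool * bool)%type.
Definition cls2_add (x y : cls2) : cls2 := (x.1.1 (+) y.1.1, x.1.2 (+) y.1.2, x.2 (+) y.2).
Definition cls2_hilbert (x y : cls2) : bool :=
  (x.1.2 && y.1.2) (+) (x.1.1 && y.2) (+) (y.1.1 && x.2).

(** [m1] is the class of -1. [<b, c>] represents u when u b has the form x^2 + b c y^2, i.e. is a
    norm from the field of sqrt(-bc): hence (-bc, ub), and likewise for [<1, a>] and [<t, u>]. *)
Definition local_solution (T : Type) (add : T -> T -> T) (h : T -> T -> bool) (m1 a b c d : T) (tu : T * T) : bool :=
  let: (t, u) := tu in
  [&& ~~ h (add m1 a) t, ~~ h (add m1 (add b c)) (add u b) & ~~ h (add m1 (add t u)) (add t d)].

(** Quantifiers written as plain boolean conjunctions, so that [vm_compute] can run the finite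
    check. *)
Definition allb (f : bool -> bool) := f true && f false.
Lemma allbP f : allb f -> forall b, f b. Proof. by case/andP => ? ? []. Qed.

Definition all_cls (f : cls -> bool) := allb (fun x => allb (fun y => f (x, y))).
Lemma all_clsP f : all_cls f -> forall x, f x.
Proof. by move=> h [x y]; have := allbP (allbP h x) y. Qed.
Definition all_cls2 (f : cls2 -> bool) := allb (fun x => all_cls (fun y => f (x, y.1, y.2))).
Lemma all_cls2P f : all_cls2 f -> forall x, f x.
Proof. by move=> h [[x y] z]; have := all_clsP (allbP h x) (y, z). Qed.

Lemma allbI (f : bool -> bool) : (forall b, f b) -> allb f.
Proof. by move=> h; rewrite /allb !h. Qed.
Lemma all_clsI (f : cls -> bool) : (forall x, f x) -> all_cls f.
Proof. by move=> h; do 2!apply: allbI => ?; apply: h. Qed.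
Lemma all_cls2I (f : cls2 -> bool) : (forall x, f x) -> all_cls2 f.
Proof. by move=> h; apply: allbI => ?; apply: all_clsI => ?; apply: h. Qed.

(** The symbol at an odd p depends on p only through e, the residue bit of -1, so one finite check
    covers all odd primes. *)
Lemma local_solution_odd e (a b c d : cls) :
  exists tu, local_solution cls_add (cls_hilbert e) (false, e) a b c d tu.
Proof.
pose g e a b c d := ~~ all_cls (fun t => all_cls (fun u =>
  ~~ local_solution cls_add (cls_hilbert e) (false, e) a b c d (t, u))).
have H : allb (fun e => all_cls (fun a => all_cls (fun b => all_cls (fun c => all_cls (fun d => g e a b c d))))).
  by vm_compute.
have := all_clsP (all_clsP (all_clsP (all_clsP (allbP H e) a) b) c) d.
rewrite /g => h; apply/existsP; apply: contraR h; rewrite negb_exists => /forallP h.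
by do 2!apply: all_clsI => ?; apply: h.
Qed.

Lemma local_solution_two (a b c d : cls2) :
  exists tu, local_solution cls2_add cls2_hilbert (false, true, false) a b c d tu.
Proof.
pose g a b c d := ~~ all_cls2 (fun t => all_cls2 (fun u =>
  ~~ local_solution cls2_add cls2_hilbert (false, true, false) a b c d (t, u))).
have H : all_cls2 (fun a => all_cls2 (fun b => all_cls2 (fun c => all_cls2 (fun d => g a b c d)))).
  by vm_compute.
have := all_cls2P (all_cls2P (all_cls2P (all_cls2P H a) b) c) d.
rewrite /g => h; apply/existsP; apply: contraR h; rewrite negb_exists => /forallP h.
by do 2!apply: all_cls2I => ?; apply: h.
Qed.

Definition cls_of (p : nat) (x : int) : cls := (val_odd p x, res_bit p x).
Definition cls2_of (x : int) : cls2 := (val_odd 2 x, eps2 x, omega2 x).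

Lemma cls_ofM p x y : prime p -> odd p -> x != 0 -> y != 0 ->
  cls_of p (x * y) = cls_add (cls_of p x) (cls_of p y).
Proof. by move=> *; rewrite /cls_of val_oddM // res_bitM. Qed.

Lemma cls2_ofM x y : x != 0 -> y != 0 -> cls2_of (x * y) = cls2_add (cls2_of x) (cls2_of y).
Proof. by move=> *; rewrite /cls2_of val_oddM // eps2M // omega2M. Qed.

Lemma cls_ofN p x : prime p -> odd p -> x != 0 ->
  cls_of p (- x) = cls_add (false, nonres p (-1)) (cls_of p x).
Proof.
by move=> pr_p odd_p x0; rewrite -(mulN1r x) cls_ofM // [cls_of p (-1)]/cls_of val_oddN1 res_bitN1.
Qed.

Lemma cls2_ofN x : x != 0 -> cls2_of (- x) = cls2_add (false, true, false) (cls2_of x).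
Proof. by move=> x0; rewrite -(mulN1r x) cls2_ofM // [cls2_of (-1)]/cls2_of val_oddN1 eps2N1 omega2N1. Qed.

(* The integers [t] and [u] are controlled at every place but one auxiliary prime
   each; [q], the one of [t], is among the controlled places of [u]. *)
Theorem global_solution (a b c d : int) : a != 0 -> b != 0 -> c != 0 -> 0 < d ->
  exists t u : int, [/\ t != 0, u != 0 &
    [/\ represented (- a) t, represented (- (b * c)) (u * b) & represented (- (t * u)) (t * d)]].
Proof.
move=> a0 b0 c0 dpos; have d0 : d != 0 by rewrite gt_eqF.
pose D := `|(a * b * c * d)%R|%N; pose S := [seq p <- primes D | odd p].
have D0 : (0 < D)%N by rewrite absz_gt0 !mulf_neq0.
have hS p : p \in S -> prime p && odd p.
  by rewrite mem_filter mem_primes => /andP[-> /andP[->]].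
have uS : uniq S by rewrite filter_uniq // primes_uniq.
have outS l : prime l -> odd l -> l \notin S ->
    [/\ ~~ (l %| `|a|)%N, ~~ (l %| `|b|)%N, ~~ (l %| `|c|)%N & ~~ (l %| `|d|)%N].
  move=> pr_l odd_l; rewrite mem_filter odd_l mem_primes pr_l D0 /= /D !abszM !Euclid_dvdM //.
  by rewrite !negb_or => /andP[/andP[/andP[]]].
pose f p := xchoose (local_solution_odd (nonres p (-1)) (cls_of p a) (cls_of p b) (cls_of p c) (cls_of p d)).
have fP p := xchooseP (local_solution_odd (nonres p (-1)) (cls_of p a) (cls_of p b) (cls_of p c) (cls_of p d)).
have [[t2 u2] /and3P[h2a h2b h2c]] := local_solution_two (cls2_of a) (cls2_of b) (cls2_of c) (cls2_of d).
have [t [q [[t0 pr_q odd_q qS] [[tv2 te to tpos] [tS tl]]]]] :=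
  int_with_local_classes (fun p => (f p).1.1) (fun p => (f p).1.2) t2.1.1 t2.1.2 t2.2 false uS hS.
have hS' p : p \in q :: S -> prime p && odd p.
  by rewrite in_cons => /orP[/eqP ->|/hS //]; rewrite pr_q.
have uS' : uniq (q :: S) by rewrite /= qS.
(* At q, where the class of t is unknown, u receives the class of d, which is a unit there. Its sign
   is that of b, so that u b > 0. *)
have [u [q' [[u0 pr_q' odd_q' qS'] [[uv2 ue uo usg] [uS1 ul]]]]] :=
  int_with_local_classes (fun p => if p == q then false else (f p).2.1)
   (fun p => if p == q then res_bit q d else (f p).2.2) u2.1.1 u2.1.2 u2.2 (b < 0) uS' hS'.
have {}tpos : 0 < t by rewrite lt_neqAle eq_sym t0 leNgt tpos.
have ub : 0 < u * b.
  have : u * b != 0 by rewrite mulf_neq0.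
  by rewrite neq_lt => /orP[|//]; rewrite ltz0M // usg addbb.
have t2E : cls2_of t = t2 by rewrite /cls2_of tv2 te to; case: (t2) => [[]].
have u2E : cls2_of u = u2 by rewrite /cls2_of uv2 ue uo; case: (u2) => [[]].
have tSE p : p \in S -> cls_of p t = (f p).1 by move=> /tS[h1 h2]; rewrite /cls_of h1 h2; case: (f p).1.
have uSE p : p \in S -> cls_of p u = (f p).2.
  move=> pS; have pq : (p == q) = false by apply/negP => /eqP pq; rewrite -pq pS in qS.
  by have := uS1 p; rewrite in_cons pS orbT pq => /(_ isT)[h1 h2]; rewrite /cls_of h1 h2; case: (f p).2.
have hilbertE p x y : hilbert p x y = cls_hilbert (nonres p (-1)) (cls_of p x) (cls_of p y) by [].
have hilbert2E x y : hilbert2 x y = cls2_hilbert (cls2_of x) (cls2_of y) by [].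
have q'q : q' != q by apply: contraNneq qS' => ->; rewrite mem_head.
have q'S : q' \notin S by move: qS'; rewrite in_cons negb_or => /andP[].
have [qa qb qc qd] := outS q pr_q odd_q qS.
have vqu : val_odd q u = false by have [] := uS1 q (mem_head _ _); rewrite eqxx.
have rqu : res_bit q u = res_bit q d by have [_] := uS1 q (mem_head _ _); rewrite eqxx.
have local p : p \in S -> [/\ hilbert p (- a) t = false, hilbert p (- (b * c)) (u * b) = false &
    hilbert p (- (t * u)) (t * d) = false].
  move=> pS; have /andP[pr_p odd_p] := hS p pS.
  rewrite !hilbertE !cls_ofN ?mulf_neq0 // !cls_ofM // tSE // uSE //.
  by move: (fP p); rewrite -/(f p); case: (f p) => tp up /and3P[/negbTE -> /negbTE -> /negbTE ->].
exists t, u; split => //; split; apply: legendre; rewrite ?oppr_eq0 ?mulf_neq0 //.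
- apply: (hilbert_last _ _ pr_q); rewrite ?oppr_eq0 //.
  + move=> l pr_l odd_l lq; have [/local[]//|lS] := boolP (l \in S).
    have [la _ _ _] := outS l pr_l odd_l lS.
    by apply: hilbert_unit; rewrite ?abszN // tl.
  + by rewrite hilbert2E cls2_ofN // t2E; apply: negbTE.
  + by rewrite /hilbert_oo [t < 0]ltNge (ltW tpos) andbF.
- by rewrite /hilbert_oo [t < 0]ltNge (ltW tpos) andbF.
- apply: (hilbert_last _ _ pr_q'); rewrite ?oppr_eq0 ?mulf_neq0 //.
  + move=> l pr_l odd_l lq'; have [/local[]//|lS] := boolP (l \in S).
    have [_ lb lc _] := outS l pr_l odd_l lS.
    have [->|lq] := eqVneq l q.
      have v1 : val_odd q (- (b * c)) = false.
        by apply: val_odd_ndvd; rewrite abszN abszM Euclid_dvdM // negb_or qb.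
      by rewrite /hilbert v1 val_oddM // vqu (val_odd_ndvd qb).
    by apply: hilbert_unit; rewrite ?abszN abszM Euclid_dvdM // negb_or ?lb ?lc ?ul ?in_cons ?negb_or ?lq.
  + by rewrite hilbert2E cls2_ofN ?mulf_neq0 // !cls2_ofM // u2E; apply: negbTE.
  + by rewrite /hilbert_oo [u * b < 0]ltNge (ltW ub) andbF.
- by rewrite /hilbert_oo [u * b < 0]ltNge (ltW ub) andbF.
- apply: (hilbert_last _ _ pr_q'); rewrite ?oppr_eq0 ?mulf_neq0 //.
  + move=> l pr_l odd_l lq'; have [/local[]//|lS] := boolP (l \in S).
    have [_ _ _ ld] := outS l pr_l odd_l lS.
    have [->|lq] := eqVneq l q.
      (* The symbol at q is now (-td, td), trivial whatever the class of t. *)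
      rewrite hilbertE cls_ofN ?mulf_neq0 // !cls_ofM // /cls_of vqu rqu (val_odd_ndvd qd).
      by rewrite /cls_hilbert /=; case: (val_odd q t); case: (res_bit q t); case: (res_bit q d); case: (nonres q (-1)).
    by apply: hilbert_unit; rewrite ?abszN abszM Euclid_dvdM // negb_or tl ?ld ?ul ?in_cons ?negb_or ?lq.
  + by rewrite hilbert2E cls2_ofN ?mulf_neq0 // !cls2_ofM // t2E u2E; apply: negbTE.
  + by rewrite /hilbert_oo [t * d < 0]ltNge (ltW (mulr_gt0 tpos dpos)) andbF.
- by rewrite /hilbert_oo [t * d < 0]ltNge (ltW (mulr_gt0 tpos dpos)) andbF.
Qed.

(** * Diagonal rational quadratic forms *)

Definition binary_value (b c u : rat) := exists x y : rat, u = b * x ^+ 2 + c * y ^+ 2.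

(** For z != 0, divide u b z^2 = x^2 + b c y^2 by b z^2. *)
Lemma binary_value_of_ternary (b c u y z x : rat) : b != 0 -> c != 0 -> u != 0 ->
  (y != 0) || (z != 0) || (x != 0) -> - (b * c) * y ^+ 2 + u * b * z ^+ 2 = x ^+ 2 ->
  binary_value b c u.
Proof.
move=> b0 c0 u0 nz e; have [z0|z0] := eqVneq z 0; last first.
  exists (x / (b * z)), (y / z).
  have -> : b * (x / (b * z)) ^+ 2 + c * (y / z) ^+ 2 = (x ^+ 2 + b * c * y ^+ 2) / (b * z ^+ 2).
    by field; rewrite z0 b0.
  by rewrite -e; field; rewrite z0 b0.
(* here the binary form is a hyperbolic plane, hence universal *)
have {}e : x ^+ 2 = - (b * c) * y ^+ 2 by rewrite -e z0 expr0n /= mulr0 addr0.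
have y0 : y != 0.
  apply: contraTneq nz => y0; move: e; rewrite y0 z0 eqxx /= expr0n /= mulr0 => /eqP.
  by rewrite sqrf_eq0 => /eqP ->; rewrite eqxx.
have x0 : x != 0 by rewrite -sqrf_eq0 e !mulf_neq0 ?oppr_eq0 ?mulf_neq0 ?expf_neq0.
(* u / b is the difference of the squares of (u/b + 1)/2 and (u/b - 1)/2, and c (b y / x)^2 = -b
   supplies the minus sign. *)
exists ((u / b + 1) / 2), (b * y / x * (u / b - 1) / 2).
have -> : c * (b * y / x * (u / b - 1) / 2) ^+ 2 = - b * (- (b * c) * y ^+ 2) / x ^+ 2 * ((u / b - 1) / 2) ^+ 2.
  by field; rewrite x0 b0.
by rewrite -e; field; rewrite x0 b0.
Qed.

Lemma binary_value_of_represented (b c u : int) : b != 0 -> c != 0 -> u != 0 ->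
  represented (- (b * c)) (u * b) -> binary_value b%:~R c%:~R u%:~R.
Proof.
move=> b0 c0 u0 [y [z [x [nz e]]]].
apply: (@binary_value_of_ternary _ _ _ y%:~R z%:~R x%:~R); rewrite ?intr_eq0 //.
by rewrite -!rmorphXn -!rmorphM -rmorphN -rmorphM -rmorphD /= e.
Qed.

Lemma binary_value_scale (b c u k l m : rat) : k != 0 -> l != 0 -> m != 0 ->
  binary_value (b * k ^+ 2) (c * l ^+ 2) (u * m ^+ 2) -> binary_value b c u.
Proof.
move=> k0 l0 m0 [x [y e]]; exists (k * x / m), (l * y / m).
apply: (mulIf (expf_neq0 2 m0)); rewrite e; field; exact: m0.
Qed.

(** An integer in the square class of x. *)
Definition rat_int (x : rat) : int := numq x * denq x.

Lemma rat_intE x : (rat_int x)%:~R = x * (denq x)%:~R ^+ 2 :> rat.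
Proof.
by rewrite /rat_int intrM numqE expr2 mulrA.
Qed.

Lemma rat_int_neq0 x : x != 0 -> rat_int x != 0.
Proof. by move=> x0; rewrite mulf_neq0 ?denq_neq0 ?numq_eq0. Qed.

Lemma binary_chain_pos (a b c d : rat) : a != 0 -> b != 0 -> c != 0 -> 0 < d ->
  exists t u : rat, [/\ t != 0, u != 0 & [/\ binary_value 1 a t, binary_value b c u & binary_value t u d]].
Proof.
move=> a0 b0 c0 d0.
have den0 x : (denq x)%:~R != 0 :> rat by rewrite intr_eq0 denq_neq0.
have dpos : 0 < rat_int d by rewrite /rat_int mulr_gt0 ?denq_gt0 ?numq_gt0.
have [t [u [t0 u0 [ht hu hd]]]] :=
  global_solution (rat_int_neq0 a0) (rat_int_neq0 b0) (rat_int_neq0 c0) dpos.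
exists t%:~R, u%:~R; rewrite !intr_eq0; split => //; split.
- apply: (@binary_value_scale _ _ _ 1 (denq a)%:~R 1) => //.
  rewrite -(rat_intE a) !expr1n !mulr1.
  have := @binary_value_of_represented 1 (rat_int a) t; rewrite mul1r mulr1 mulr1z.
  by apply; rewrite ?rat_int_neq0.
- apply: (@binary_value_scale _ _ _ (denq b)%:~R (denq c)%:~R 1) => //.
  by rewrite -(rat_intE b) -(rat_intE c) expr1n mulr1; apply: binary_value_of_represented; rewrite ?rat_int_neq0.
- apply: (@binary_value_scale _ _ _ 1 1 (denq d)%:~R) => //.
  rewrite -(rat_intE d) !expr1n !mulr1.
  by apply: binary_value_of_represented; rewrite ?rat_int_neq0 ?(gt_eqF d0) // [rat_int d * t]mulrC.
Qed.

Lemma binary_valueN (b c u : rat) : binary_value (- b) (- c) (- u) -> binary_value b c u.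
Proof. by move=> [x [y e]]; exists x, y; apply: oppr_inj; rewrite e; ring. Qed.

Lemma binary_chain (sg : bool) (a b c d : rat) : a != 0 -> b != 0 -> c != 0 -> d != 0 -> (d < 0) = sg ->
  exists t u : rat, [/\ t != 0, u != 0 &
    [/\ binary_value ((-1) ^+ sg) a t, binary_value b c u & binary_value t u d]].
Proof.
move=> a0 b0 c0 d0; case: sg => sg; last first.
  by apply: binary_chain_pos => //; rewrite lt_neqAle eq_sym d0 leNgt sg.
have [||||t [u [t0 u0 [ht hu hd]]]] := @binary_chain_pos (- a) (- b) (- c) (- d); rewrite ?oppr_eq0 ?oppr_gt0 //.
exists (- t), (- u); rewrite !oppr_eq0; split => //.
by split; apply: binary_valueN; rewrite ?expr1 ?opprK.
Qed.

Definition diag_form m (g : 'I_m -> rat) (x : 'rV[rat]_m) : rat := \sum_i g i * x 0 i ^+ 2.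

(** A representation, so that composition is matrix multiplication; injectivity is recovered at the
    end by [row_free_of_diag]. *)
Definition diag_rep m (g h : 'I_m -> rat) :=
  exists M : 'M[rat]_m, forall x, diag_form g (x *m M) = diag_form h x.

Lemma diag_rep_refl m (g : 'I_m -> rat) : diag_rep g g.
Proof. by exists 1%:M => x; rewrite mulmx1. Qed.

Lemma diag_rep_trans m (g h k : 'I_m -> rat) : diag_rep g h -> diag_rep h k -> diag_rep g k.
Proof. by move=> [M hM] [N hN]; exists (N *m M) => x; rewrite mulmxA hM hN. Qed.

(** In the plane of i and j, the vector (x, y) has value t; (- g_j y, g_i x) is orthogonal to it and
    has value g_i g_j t. *)
Lemma diag_rep_move m (g : 'I_m -> rat) (i j : 'I_m) (t : rat) : i != j -> g i != 0 -> g j != 0 -> t != 0 ->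
  binary_value (g i) (g j) t ->
  exists h : 'I_m -> rat, [/\ diag_rep g h, h i = t, h j != 0 & forall k, k != i -> k != j -> h k = g k].
Proof.
move=> ij gi0 gj0 t0 [x [y tE]].
exists (fun k => if k == i then t else if k == j then g i * g j * t else g k); split; [| by rewrite eqxx
  | by rewrite [j == i]eq_sym (negbTE ij) eqxx !mulf_neq0 | by move=> k /negbTE -> /negbTE ->].
have ji : (j == i) = false by rewrite eq_sym (negbTE ij).
pose M : 'M[rat]_m := \matrix_(k, l)
  (if k == i then (if l == i then x else if l == j then y else 0)
   else if k == j then (if l == i then - (g j * y) else if l == j then g i * x else 0)
   else (k == l)%:R).
exists M => z.
have Mij l : (l == i) || (l == j) -> (z *m M) 0 l = z 0 i * M i l + z 0 j * M j l.
  move=> lij; rewrite mxE (bigD1 i) // (bigD1 j) ?ji //= big1 ?addr0 // => k /andP[/negbTE ki /negbTE kj].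
  by rewrite mxE ki kj; case/orP: lij => /eqP ->; rewrite ?ki ?kj mulr0.
have Mi : (z *m M) 0 i = z 0 i * x - z 0 j * (g j * y).
  by rewrite Mij ?eqxx // !mxE !eqxx ji mulrN.
have Mj : (z *m M) 0 j = z 0 i * y + z 0 j * (g i * x).
  by rewrite Mij ?eqxx ?orbT // !mxE !eqxx ji.
have Mk k : k != i -> k != j -> (z *m M) 0 k = z 0 k.
  move=> /negbTE ki /negbTE kj; rewrite mxE (bigD1 k) //= mxE ki kj eqxx mulr1.
  rewrite big1 ?addr0 // => l /negbTE lk; rewrite mxE lk ki kj.
  by rewrite !if_same mulr0.
rewrite /diag_form (bigD1 i) // (bigD1 j) ?ji //= [RHS](bigD1 i) // [X in _ = _ + X](bigD1 j) ?ji //=.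
rewrite Mi Mj !eqxx !addrA; congr (_ + _); first by rewrite tE; ring.
by apply: eq_bigr => k /andP[ki kj]; rewrite Mk // (negbTE ki) (negbTE kj).
Qed.

(** Three plane moves: t appears at i using j1, u at j2 using j3, then d at i using j2. *)
Lemma diag_rep_replace m (g : 'I_m -> rat) (sg : bool) (i j1 j2 j3 : 'I_m) (d : rat) :
  uniq [:: i; j1; j2; j3] -> (forall k, g k != 0) -> g i = (-1) ^+ sg -> d != 0 -> (d < 0) = sg ->
  exists h : 'I_m -> rat, [/\ diag_rep g h, forall k, h k != 0, h i = d &
    forall k, k \notin [:: i; j1; j2; j3] -> h k = g k].
Proof.
rewrite /= !inE !negb_or => /andP[/and3P[i1 i2 i3] /andP[/andP[j12 j13] /andP[j23 _]]] g0 gi d0 sgd.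
have [t [u [t0 u0 [ht hu hd]]]] := binary_chain (g0 j1) (g0 j2) (g0 j3) d0 sgd.
rewrite -gi in ht.
have [h1 [r1 h1i h1j h1k]] := diag_rep_move i1 (g0 i) (g0 j1) t0 ht.
have e2 : h1 j2 = g j2 by apply: h1k; rewrite eq_sym.
have e3 : h1 j3 = g j3 by apply: h1k; rewrite eq_sym.
rewrite -e2 -e3 in hu.
have n2 : h1 j2 != 0 by rewrite e2.
have n3 : h1 j3 != 0 by rewrite e3.
have [h2 [r2 h2j2 h2j3 h2k]] := diag_rep_move j23 n2 n3 u0 hu.
have e2i : h2 i = t by rewrite h2k.
have e2j1 : h2 j1 != 0 by rewrite h2k.
have n2i : h2 i != 0 by rewrite e2i.
have n2j2 : h2 j2 != 0 by rewrite h2j2.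
rewrite -e2i -h2j2 in hd.
have [h3 [r3 h3i h3j2 h3k]] := diag_rep_move i2 n2i n2j2 d0 hd.
have keep k : k \notin [:: i; j1; j2; j3] -> h3 k = g k.
  by rewrite !inE !negb_or => /and4P[ki k1 k2 k3]; rewrite h3k // h2k // h1k.
exists h3; split => //; first exact: diag_rep_trans (diag_rep_trans r1 r2) r3.
move=> k; have [->|ki] := eqVneq k i; first by rewrite h3i.
have [->|k2] := eqVneq k j2; first by [].
have [->|k1] := eqVneq k j1; first by rewrite h3k // eq_sym.
have [->|k3] := eqVneq k j3; first by rewrite h3k // eq_sym.
by rewrite keep // !inE !negb_or ki k1 k2 k3.
Qed.

Lemma diag_rep_replace_all n m (g : 'I_m -> rat) (f : 'I_n -> 'I_m) (j1 j2 j3 : 'I_m) (d : 'I_n -> rat) :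
  injective f -> uniq [:: j1; j2; j3] -> (forall i, f i \notin [:: j1; j2; j3]) ->
  (forall k, g k != 0) -> (forall i, d i != 0) -> (forall i, g (f i) = (-1) ^+ (d i < 0)%R) ->
  exists h : 'I_m -> rat, diag_rep g h /\ forall i, h (f i) = d i.
Proof.
move=> f_inj uj fj g0 d0 gf.
have step : forall k, (k <= n)%N -> exists h : 'I_m -> rat, [/\ diag_rep g h, forall l, h l != 0,
    forall i : 'I_n, (i < k)%N -> h (f i) = d i & forall i : 'I_n, (k <= i)%N -> h (f i) = g (f i)].
  elim=> [_|k IH kn]; first by exists g; split => //; exact: diag_rep_refl.
  have [h [r h0 hlt hge]] := IH (ltnW kn); pose i := Ordinal kn.
  have hi : h (f i) = (-1) ^+ (d i < 0)%R by rewrite hge // gf.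
  have ui : uniq [:: f i; j1; j2; j3] by rewrite cons_uniq fj uj.
  have [h' [r' h'0 h'i h'k]] := diag_rep_replace ui h0 hi (d0 i) erefl.
  have other (l : 'I_n) : l != i -> h' (f l) = h (f l).
    by move=> li; apply: h'k; rewrite in_cons negb_or (inj_eq f_inj) li fj.
  exists h'; split => // [||l lk]; first exact: diag_rep_trans r r'.
    move=> l lk; have [->//|li] := eqVneq l i; rewrite other // hlt //.
    by move: li; rewrite -val_eqE /=; lia.
  by rewrite other ?hge 1?ltnW // -val_eqE /=; lia.
by have [h [r h0 hd _]] := step n (leqnn n); exists h; split => // i; apply: hd.
Qed.

(** * Matching signs and assembling the embedding *)

Lemma card_le_injection (T U : finType) (y0 : U) (A : {set T}) (B : {set U}) : (#|A| <= #|B|)%N ->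
  exists2 f : T -> U, {in A &, injective f} & forall x, x \in A -> f x \in B.
Proof.
move=> cAB; have lt x : x \in A -> (index x (enum A) < size (enum B))%N.
  by move=> xA; rewrite -cardE (leq_trans _ cAB) // cardE index_mem mem_enum.
exists (fun x => nth y0 (enum B) (index x (enum A))) => [x y xA yA|x xA].
  move/eqP; rewrite nth_uniq ?enum_uniq ?lt // => /eqP h.
  by rewrite -(nth_index x (_ : x \in enum A)) ?mem_enum // h nth_index ?mem_enum.
by rewrite -mem_enum mem_nth ?lt.
Qed.

(** The two counts exhaust n, so no coefficient is zero; positive and negative indices are then
    injected separately, and the values of e keep the images apart. *)
Lemma sign_injection n m (y0 : 'I_m) (d : 'I_n -> rat) (e : 'I_m -> bool) :
  (#|[set i | (0 < d i)%R]| + #|[set i | (d i < 0)%R]| = n)%N ->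
  (#|[set i | (0 < d i)%R]| <= #|[set i | e i]|)%N ->
  (#|[set i | (d i < 0)%R]| <= #|[set i | ~~ e i]|)%N ->
  (forall i, d i != 0) /\ exists2 f : 'I_n -> 'I_m, injective f & forall i, e (f i) = ~~ (d i < 0).
Proof.
set P := [set i | (0 < d i)%R]; set N := [set i | (d i < 0)%R]; set E := [set i | e i]; set E' := [set i | ~~ e i].
move=> cPN cP cN.
have PN : P :|: N = setT.
  apply/eqP; rewrite eqEcard subsetT cardsT card_ord cardsU cPN /=.
  rewrite (_ : P :&: N = set0) ?cards0 ?subn0 //; apply/setP => i; rewrite !inE.
  by apply/negP => /andP[h1 /(lt_trans h1)]; rewrite ltxx.
have d0 i : d i != 0.
  by have := in_setT i; rewrite -PN !inE neq_lt orbC.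
split => //.
have pos i : ~~ (d i < 0) -> i \in P by move=> di; rewrite inE lt_neqAle eq_sym d0 leNgt.
have neg i : d i < 0 -> i \in N by rewrite inE.
have [f1 inj1 h1] := card_le_injection y0 cP.
have [f2 inj2 h2] := card_le_injection y0 cN.
have hf1 i : ~~ (d i < 0) -> e (f1 i) by move=> /pos/h1; rewrite inE.
have hf2 i : d i < 0 -> ~~ e (f2 i) by move=> /neg/h2; rewrite inE.
exists (fun i => if d i < 0 then f2 i else f1 i) => [i j|i].
  case: (boolP (d i < 0)) => di; case: (boolP (d j < 0)) => dj fij.
  - by apply: inj2 => //; apply: neg.
  - by have := hf2 i di; rewrite fij hf1.
  - by have := hf2 j dj; rewrite -fij hf1.
  - by apply: inj1 => //; apply: pos.
by case: (boolP (d i < 0)) => di; [apply/negbTE/hf2|apply: hf1].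
Qed.

(** Translation by a kernel vector x preserves the form. Evaluating at 0 and at the k-th basis
    vector leaves 2 d_k x_k = 0. *)
Lemma row_free_of_diag n m (M : 'M[rat]_(n, m)) (Q : 'rV[rat]_m -> rat) (d : 'I_n -> rat) :
  (forall i, d i != 0) -> (forall x, Q (x *m M) = diag_form d x) -> row_free M.
Proof.
move=> d0 hM; apply: inj_row_free => x xM.
have sum0 y : diag_form d (x + y) = diag_form d y by rewrite -!hM mulmxDl xM add0r.
apply/rowP => k; rewrite mxE; pose D : 'rV[rat]_n := delta_mx 0 k.
have := sum0 0; have := sum0 D.
rewrite addr0 /diag_form => h1 h0.
have e : \sum_i d i * (x + D) 0 i ^+ 2 =
    \sum_i d i * x 0 i ^+ 2 + (\sum_i d i * D 0 i ^+ 2 + 2 * d k * x 0 k).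
  have -> : 2 * d k * x 0 k = \sum_i 2 * d i * x 0 i * D 0 i.
    rewrite (bigD1 k) //= /D mxE !eqxx mulr1 big1 ?addr0 // => i /negbTE ik.
    by rewrite mxE ik andbF mulr0.
  by rewrite -!big_split /=; apply: eq_bigr => i _; rewrite mxE; ring.
have z : \sum_i d i * (0 : 'rV[rat]_n) 0 i ^+ 2 = 0 by rewrite big1 // => i _; rewrite mxE expr0n mulr0.
rewrite z in h0; rewrite e h0 add0r in h1.
have : 2 * d k * x 0 k = 0 by apply: (addrI (\sum_i d i * D 0 i ^+ 2)); rewrite h1 addr0.
by move/eqP; rewrite !mulf_eq0 (negbTE (d0 k)) /= => /eqP.
Qed.

Theorem mainTheorem7 (n : nat) (A : 'M[int]_n) (r s : nat) :
  lat_nondeg A ->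
  has_signature (ratq A) r s ->
  forall r' s' : nat,
    (r', s') \in [:: (r + 3, s); (r + 2, s + 1); (r + 1, s + 2); (r, s + 3)]%N ->
    forall e : 'I_(n + 3) -> bool,
      #|[set i | e i]| = r' -> #|[set i | ~~ e i]| = s' ->
      exists M : 'M[rat]_(n, n + 3),
        isometric_embedding (ratq A) (qst e) M.
Proof.
move=> _ [P [uP [d [dQ [dr ds]]]]] r' s' rs' e er es.
have rs : (r' + s' = n + 3)%N.
  rewrite -er -es; apply: etrans (card_ord (n + 3)); rewrite -(cardsC [set i | e i]); congr (_ + _)%N.
  by apply: eq_card => i; rewrite !inE.
(* Together with r' + s' = n + 3 this gives r + s = n, so all n diagonal coefficients are
   nonzero. *)
have [rr ss rs3] : [/\ r <= r', s <= s' & r' + s' = r + s + 3]%N.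
  by move: rs'; rewrite !inE => /or4P[] /eqP[-> ->]; split; lia.
have y0 : 'I_(n + 3) := rshift n ord0.
have [|||d0 [f f_inj fe]] := @sign_injection n (n + 3) y0 (d 0) e.
- by rewrite dr ds; lia.
- by rewrite dr er.
- by rewrite ds es.
(* The three coordinates missed by f are the spare a, b, c of every exchange. *)
have : size (enum (~: [set f i | i in 'I_n])) = 3%N.
  have := cardsC [set f i | i in 'I_n]; rewrite card_imset // !card_ord -cardE; lia.
have := enum_uniq (~: [set f i | i in 'I_n]).
have : forall j, j \in enum (~: [set f i | i in 'I_n]) -> forall i, f i != j.
  move=> j; rewrite mem_enum inE => h i; apply: contraNneq h => <-; exact: imset_f.
case: (enum _) => [|j1 [|j2 [|j3 [|]]]] // hj uj _.
pose g (i : 'I_(n + 3)) : rat := if e i then 1 else -1.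
have [|||h [[M hM] hd]] := @diag_rep_replace_all n (n + 3) g f j1 j2 j3 (d 0) f_inj uj _ _ d0.
- by move=> i; apply/negP => /hj /(_ i); rewrite eqxx.
- by move=> k; rewrite /g; case: ifP; rewrite ?oppr_eq0 oner_eq0.
- by move=> i; rewrite /g fe; case: (d 0 i < 0).
(* Coordinate inclusion along f: it restricts the exchanged form h to [<d_1, ..., d_n>]. *)
pose F : 'M[rat]_(n, n + 3) := \matrix_(i, k) (k == f i)%:R.
have hF x : diag_form h (x *m F) = diag_form (d 0) x.
  have xF k : (x *m F) 0 k = \sum_i x 0 i * (k == f i)%:R by rewrite mxE; apply: eq_bigr => i _; rewrite mxE.
  rewrite /diag_form (bigID (mem [set f i | i in 'I_n])) /= addrC big1 ?add0r; last first.
    move=> k kf; rewrite xF big1 ?expr0n ?mulr0 // => i _.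
    by case: eqP kf => [->|_ _]; rewrite ?mulr0 // imset_f.
  rewrite big_imset //=; last by move=> i j _ _; apply: f_inj.
  apply: eq_bigr => i _; rewrite hd xF (bigD1 i) //= eqxx mulr1 big1 ?addr0 // => k /negbTE ki.
  by rewrite (inj_eq f_inj) eq_sym ki mulr0.
have hQ x : qst e (x *m (F *m M)) = diag_form (d 0) x.
  by rewrite mulmxA -hF -hM.
exists (invmx P *m (F *m M)); split; last first.
  move=> x; rewrite mulmxA hQ /diag_form -dQ mulmxKV //.
have free := row_free_of_diag d0 hQ.
by rewrite /row_free mxrankMfree // -/(row_free _) row_free_unit unitmx_inv.
Qed.
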